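(* Let $\mathfrak g$ be a simple Lie algebra over $k$ and let $J=\sum_{i\in I}\varpi_i\otimes q_i\in\mathfrak h\otimes S(\mathfrak h)$ be a non-zero Zhelobenko invariant (for the adjoint module). Let $m$ be the common degree of the $q_i$, $i\in I$. Then $$(e^\vee)^{m+1}\Big(\sum_{i\in I}\varpi_i\,q_i(s\rho)\Big)=0\qquad\text{for all } s\in k .$$
   Context: $k$ is an algebraically closed field of characteristic $0$; $\mathfrak g$ is a simple Lie algebra over $k$ with Cartan subalgebra $\mathfrak h$, root system $\Delta\subset\mathfrak h^*$, positive roots $\Delta^+$, simple roots $\pi=\{\alpha_i\}_{i\in I}$, $I=\{1,\dots,\ell\}$, simple reflections $s_i$ generating the Weyl group $W$, simple coroots $h_i=\alpha_i^\vee\in\mathfrak h$, fundamental weights $\varpi_i$ ($h_j(\varpi_i)=\delta_{ij}$), and $\rho$ the half sum of the positive roots. $e_i,h_i,f_i$ is the s-triple ($\mathfrak{sl}_2$-triple) attached to $\alpha_i$. One identifies $\mathfrak h$ with $\mathfrak h^*$ through the Cartan inner product, so that $\varpi_i$ and $\alpha_i$ are also regarded as elements of $\mathfrak h$. $S(\mathfrak h)$ is the algebra of polynomial functions on $\mathfrak h^*$, and $q(s\rho)$ is the value of $q\in S(\mathfrak h)$ at $s\rho$. Translated action: $(s_i.q)(\lambda)=q(s_i(\lambda+\rho)-\rho)$ for $q\in S(\mathfrak h)$, $\lambda\in\mathfrak h^*$. Zhelobenko operators (adjoint module, whose zero weight space is $\mathfrak h$): for $i\in I$, $v\in\mathfrak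 h$, $b\in S(\mathfrak h)$, $$\xi_i(v\otimes b)=(s_iv)\otimes (s_i.b)+[e_i,[f_i,s_iv]]\otimes h_i^{-1}(s_i.b)\in\mathfrak h\otimes \mathrm{Fract}\,S(\mathfrak h).$$ A Zhelobenko invariant is an element $J\in\mathfrak h\otimes S(\mathfrak h)$ with $\xi_i(J)=J$ for all $i\in I$; it is written uniquely as $J=\sum_{i\in I}\varpi_i\otimes q_i$ with $q_i\in S(\mathfrak h)$. (For $J\ne0$ all the $q_i$ have the same degree.) Langlands dual: $\mathfrak g^\vee$ is the simple Lie algebra whose roots are the coroots of $\mathfrak g$; its Cartan subalgebra $\mathfrak h^\vee$ is identified with $\mathfrak h^*$ and hence with $\mathfrak h$. $(e^\vee,h^\vee,f^\vee)$ is a principal s-triple of $\mathfrak g^\vee$ with $h^\vee\in\mathfrak h^\vee$ identified (up to the normalization factor) with $\rho$; thus $e^\vee$ is a sum of non-zero multiples of the simple root vectors of $\mathfrak g^\vee$. In the claim $\sum_i\varpi_iq_i(s\rho)$ is viewed as an element of $\mathfrak h\cong\mathfrak h^\vee\subset\mathfrak g^\vee$ and $e^\vee$ acts by the adjoint action of $\mathfrak g^\vee$. *)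

(* Defs.v *)
From HB Require Import structures.
From mathcomp Require Import all_boot all_order all_algebra.
From mathcomp Require Export fraction.
From mathcomp.multinomials Require Export mpoly.

Set Implicit Arguments.
Unset Strict Implicit.
Unset Printing Implicit Defensive.

Import GRing.Theory.

Local Open Scope ring_scope.

HB.mixin Record Vector_isLieAlgebra (k : fieldType) L of Vector k L := {
  lie_bracket : L -> L -> L;
  lie_linearl : forall y : L, linear (lie_bracket^~ y);
  lie_linearr : forall x : L, linear (lie_bracket x);
  lie_alternating : forall x : L, lie_bracket x x = 0;
  lie_jacobi : forall x y z : L,
    lie_bracket x (lie_bracket y z) + lie_bracket y (lie_bracket z x)
      + lie_bracket z (lie_bracket x y) = 0
}.

#[short(type="lieAlgType")]
HB.structure Definition LieAlgebra (k : fieldType) :=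
  { L of Vector_isLieAlgebra k L & Vector k L }.

Notation "[ 'lie' x , y ]" := (lie_bracket x y)
  (at level 0, x at level 99, y at level 99, format "[ 'lie'  x ,  y ]").

Section LieBracketLinear.
Context (k : fieldType) (L : lieAlgType k).

Lemma lie_bracket_is_linear (x : L) : linear (lie_bracket x).
Proof. exact: lie_linearr. Qed.

HB.instance Definition _ (x : L) :=
  GRing.isLinear.Build k L L *:%R (lie_bracket x) (lie_bracket_is_linear x).

Lemma lie_bracketPl (a : k) (x y z : L) :
  [lie a *: x + y, z] = a *: [lie x, z] + [lie y, z].
Proof. exact: lie_linearl. Qed.

End LieBracketLinear.

Definition lie_ideal (k : fieldType) (L : lieAlgType k) (I : {vspace L}) :=
  forall x y : L, y \in I -> [lie x, y] \in I.

Definition lie_simple (k : fieldType) (L : lieAlgType k) :=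
  (exists x y : L, [lie x, y] != 0) /\
  (forall I : {vspace L}, lie_ideal I -> I = 0%VS \/ I = fullv).

Definition lie_bracketv (k : fieldType) (L : lieAlgType k)
    (U V : {vspace L}) : {vspace L} :=
  <<[seq [lie x, y] | x <- vbasis U, y <- vbasis V]>>%VS.

Definition lie_nilpotent (k : fieldType) (L : lieAlgType k) (U : {vspace L}) :=
  exists r : nat, iter r (lie_bracketv U) U = 0%VS.

Definition cartan_subalgebra (k : fieldType) (L : lieAlgType k)
    (h : {vspace L}) :=
  [/\ forall x y : L, x \in h -> y \in h -> [lie x, y] \in h,
      lie_nilpotent h
    & forall x : L, (forall y, y \in h -> [lie x, y] \in h) -> x \in h].

Definition killing_form (k : fieldType) (L : lieAlgType k) (x y : L) : k :=
  \sum_(i < \dim {:L})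
    coord (vbasis {:L}) i [lie x, [lie y, (vbasis {:L})`_i]].

Lemma killing_formPr (k : fieldType) (L : lieAlgType k) (a : k) (x y z : L) :
  killing_form x (a *: y + z) = a * killing_form x y + killing_form x z.
Proof.
rewrite /killing_form mulr_sumr -big_split; apply: eq_bigr => i _.
by rewrite lie_bracketPl !linearP.
Qed.

Notation lie_dual h := 'Hom(subvs_of h, (_^o)%type).

(* The Killing form plays the role of the Cartan inner product used to identify
   h with h^*. *)
Definition killing_flat (k : fieldType) (L : lieAlgType k) (h : {vspace L})
    (v : subvs_of h) : lie_dual h :=
  linfun (fun x : subvs_of h => killing_form (vsval v) (vsval x) : k^o).

Lemma killing_flatE (k : fieldType) (L : lieAlgType k) (h : {vspace L})
  (v x : subvs_of h) : killing_flat v x = killing_form (vsval v) (vsval x).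
Proof.
pose F (x : subvs_of h) : k^o := killing_form (vsval v) (vsval x).
have linF : linear F.
  move=> a y z; have E : vsval (a *: y + z) = a *: vsval y + vsval z.
    exact: linearP.
  exact: etrans (congr1 (killing_form (vsval v)) E) (killing_formPr _ _ _ _).
pose FL := GRing.isLinear.Build _ _ _ _ F linF.
pose G : {linear subvs_of h -> k^o} := HB.pack F FL.
exact: (lfunE G x).
Qed.

Definition weight_vector (k : fieldType) (L : lieAlgType k) (h : {vspace L})
    (b : lie_dual h) (x : L) :=
  forall t : subvs_of h, [lie vsval t, x] = (b t : k) *: x.

Definition is_root (k : fieldType) (L : lieAlgType k) (h : {vspace L})
    (b : lie_dual h) :=
  b != 0 /\ (exists2 x : L, x != 0 & weight_vector b x).

Definition is_base (k : fieldType) (L : lieAlgType k) (h : {vspace L})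
    (l : nat) (alpha : 'I_l -> lie_dual h) :=
  [/\ basis_of fullv [tuple alpha i | i < l],
      forall i, is_root (alpha i)
    & forall b : lie_dual h, is_root b -> exists c : 'I_l -> nat,
        b = \sum_i alpha i *+ c i \/ b = - \sum_i alpha i *+ c i].

Definition enumerates_positive_roots (k : fieldType) (L : lieAlgType k)
    (h : {vspace L}) (l : nat) (alpha : 'I_l -> lie_dual h)
    (Dpos : seq (lie_dual h)) :=
  uniq Dpos /\
  (forall b : lie_dual h, b \in Dpos <->
    is_root b /\ exists c : 'I_l -> nat, b = \sum_i alpha i *+ c i).

Definition half_sum (k : fieldType) (L : lieAlgType k) (h : {vspace L})
    (Dpos : seq (lie_dual h)) : lie_dual h :=
  (2%:R : k)^-1 *: \sum_(b <- Dpos) b.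

(* These conditions imply [t, e] = 2 e and [t, f] = - 2 f, and they determine
   t as the coroot of b. *)
Definition root_striple (k : fieldType) (L : lieAlgType k) (h : {vspace L})
    (b : lie_dual h) (e : L) (t : subvs_of h) (f : L) :=
  [/\ weight_vector b e, weight_vector (- b) f,
      [lie e, f] = vsval t & b t = 2%:R].

Definition is_coroot (k : fieldType) (L : lieAlgType k) (h : {vspace L})
    (b : lie_dual h) (t : subvs_of h) :=
  exists e f : L, root_striple b e t f.

(* Here a is the root and t its coroot. *)
Definition refl_dual (k : fieldType) (L : lieAlgType k) (h : {vspace L})
    (a : lie_dual h) (t : subvs_of h) (lam : lie_dual h) : lie_dual h :=
  lam - (lam t : k) *: a.

Definition refl (k : fieldType) (L : lieAlgType k) (h : {vspace L})
    (a : lie_dual h) (t v : subvs_of h) : subvs_of h :=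
  v - (a v : k) *: t.

(* S(h) is modelled as {mpoly k[l]}, the variable 'X_i standing for the simple
   coroot h_i; speval q lam is the value at lam : h^* of the polynomial
   function q. *)
Definition speval (k : fieldType) (L : lieAlgType k) (h : {vspace L})
    (l : nat) (hc : 'I_l -> subvs_of h) (q : {mpoly k[l]})
    (lam : lie_dual h) : k :=
  q.@[fun i => lam (hc i)].

(* The j-th substituted polynomial is the function
   lam |-> (s_i (lam + rho) - rho)(h_j); see translated_actE. *)
Definition translated_act (k : fieldType) (L : lieAlgType k) (h : {vspace L})
    (l : nat) (alpha : 'I_l -> lie_dual h) (hc : 'I_l -> subvs_of h)
    (rho : lie_dual h) (i : 'I_l) (q : {mpoly k[l]}) : {mpoly k[l]} :=
  comp_mpoly
    [tuple ('X_j + (rho (hc j))%:MP)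
           - ('X_i + (rho (hc i))%:MP) * (alpha i (hc j))%:MP
           - (rho (hc j))%:MP | j < l] q.

Lemma translated_actE (k : fieldType) (L : lieAlgType k) (h : {vspace L})
    (l : nat) (alpha : 'I_l -> lie_dual h) (hc : 'I_l -> subvs_of h)
    (rho : lie_dual h) (i : 'I_l) (q : {mpoly k[l]}) (lam : lie_dual h) :
  speval hc (translated_act alpha hc rho i q) lam
  = speval hc q (refl_dual (alpha i) (hc i) (lam + rho) - rho).
Proof.
rewrite /speval /translated_act comp_mpoly_meval; apply: meval_eq => j.
rewrite tnth_mktuple !(mevalB, mevalD, mevalM, mevalXU, mevalC).
by rewrite /refl_dual !(add_lfunE, opp_lfunE, scale_lfunE).
Qed.

(* h (x) B, for a commutative k-algebra B, is modelled as the free module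
   'rV[B]_l of coordinates along the basis w of h; this is v (x) b. *)
Definition tens (k : fieldType) (L : lieAlgType k) (h : {vspace L})
    (l : nat) (w : l.-tuple (subvs_of h)) (v : subvs_of h)
    (b : {fraction {mpoly k[l]}}) : 'rV[{fraction {mpoly k[l]}}]_l :=
  \row_j (tofrac ((coord w j v : k)%:MP) * b).

Definition zhelobenko_pure (k : fieldType) (L : lieAlgType k)
    (h : {vspace L}) (l : nat) (alpha : 'I_l -> lie_dual h)
    (e : 'I_l -> L) (hc : 'I_l -> subvs_of h) (f : 'I_l -> L)
    (rho : lie_dual h) (w : l.-tuple (subvs_of h)) (i : 'I_l)
    (v : subvs_of h) (b : {mpoly k[l]}) : 'rV[{fraction {mpoly k[l]}}]_l :=
  let sv := refl (alpha i) (hc i) v in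
  let sb := translated_act alpha hc rho i b in
  tens w sv (tofrac sb)
  + tens w (vsproj h [lie e i, [lie f i, vsval sv]])
      ((tofrac 'X_i)^-1 * tofrac sb).

(* J stands for \sum_j w_j (x) J 0 j *)
Definition zhelobenko (k : fieldType) (L : lieAlgType k)
    (h : {vspace L}) (l : nat) (alpha : 'I_l -> lie_dual h)
    (e : 'I_l -> L) (hc : 'I_l -> subvs_of h) (f : 'I_l -> L)
    (rho : lie_dual h) (w : l.-tuple (subvs_of h)) (i : 'I_l)
    (J : 'rV[{mpoly k[l]}]_l) : 'rV[{fraction {mpoly k[l]}}]_l :=
  \sum_j zhelobenko_pure alpha e hc f rho w i (tnth w j) (J 0 j).

Definition zhelobenko_invariant (k : fieldType) (L : lieAlgType k)
    (h : {vspace L}) (l : nat) (alpha : 'I_l -> lie_dual h)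
    (e : 'I_l -> L) (hc : 'I_l -> subvs_of h) (f : 'I_l -> L)
    (rho : lie_dual h) (w : l.-tuple (subvs_of h))
    (J : 'rV[{mpoly k[l]}]_l) :=
  forall i, zhelobenko alpha e hc f rho w i J = map_mx (@tofrac _) J.

(* Langlands duality: phi identifies h^* with the Cartan subalgebra hv of Lv,
   in such a way that the roots of Lv become the coroots of L. *)
Definition langlands_identification (k : fieldType) (L Lv : lieAlgType k)
    (h : {vspace L}) (hv : {vspace Lv})
    (phi : {linear lie_dual h -> subvs_of hv}) :=
  bijective phi /\
  (forall c : lie_dual hv, is_root c <->
    exists (b : lie_dual h) (t : subvs_of h),
      [/\ is_root b, is_coroot b t & forall lam, c (phi lam) = lam t]).

(* Kostant's definition: the centralizer of the nilpositive element has
   dimension the rank. *)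
Definition principal_striple (k : fieldType) (L : lieAlgType k)
    (h : {vspace L}) (e t f : L) :=
  [/\ [lie t, e] = 2%:R *: e, [lie t, f] = - (2%:R *: f), [lie e, f] = t
    & \dim (lker (linfun (lie_bracket e))) = \dim h].

(* The factor c is left free: it equals 2 because [tv, ev] = 2 ev and ev is a
   sum of non-zero root vectors for the simple coroots hc i, seen through phi
   as the simple roots of Lv. *)
Definition adapted_principal_striple (k : fieldType) (L Lv : lieAlgType k)
    (h : {vspace L}) (hv : {vspace Lv}) (l : nat) (hc : 'I_l -> subvs_of h)
    (rho : lie_dual h) (phi : {linear lie_dual h -> subvs_of hv})
    (ev tv fv : Lv) :=
  [/\ principal_striple hv ev tv fv,
      exists c : k, tv = vsval (phi (c *: rho))
    & exists x : 'I_l -> Lv,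
        (forall i, x i != 0 /\
           forall lam : lie_dual h,
             [lie vsval (phi lam), x i] = (lam (hc i) : k) *: x i) /\
        ev = \sum_i x i].

(* Main.v *)
(** Put G(lam) = sum_i q_i(lam - rho) varpi_i.  Zhelobenko invariance amounts to
    (x + 1) (G(lam) - G(s_i lam)) = x G(lam)(h_i) alpha_i with x = lam(h_i).  Inside
    g^v, let U be spanned by h^v and all iterated brackets of the simple root
    vectors with h^v, and consider the equation u + [lam + e^v, u] = G(lam) with
    u in U.  Applying exp(x ad f_i) to a solution at lam and dropping the
    f_i-component gives a solution at s_i lam, as long as x <> -1.  For lam a
    positive multiple of a dominant regular integral weight the operator
    1 + ad(lam + e^v) is triangular with non-zero diagonal on U, so the equation is
    solvable; descending through the chambers, it is solvable at -rho/j for every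
    j >= 1.  Comparing the eigencomponents of ad rho there yields
    (e^v)^j G(-rho/j) = 0.  So the polynomial s |-> (e^v)^(m+1) G(s rho), of degree
    at most m, vanishes at -1/j for j = 1, ..., m+1, hence identically. *)

From HB Require Import structures.
Require Import Defs.
From mathcomp Require Import all_boot all_order all_algebra.
From mathcomp Require Import ring.
From Stdlib Require Import Classical IndefiniteDescription.
Import GRing.Theory.
Local Open Scope ring_scope.

Set Implicit Arguments.
Unset Strict Implicit.
Unset Printing Implicit Defensive.

(** At lam = -rho/j the operator 1 + ad(lam + e^v) is singular: its diagonal entry in degree n for
    ad rho is 1 - n/j. Solvability there is not automatic, and the zero at n = j is what cuts off
    the powers of e^v. Hence solutions are carried across chambers from the dominant side. Each wall
    is crossed from a positive value x = lam(h_i), so that x + 1 is invertible; as k has no order,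
    positivity is expressed by natural multiples of 1/j. The relations [e_i, f_j] = 0 for i <> j and
    [e_i, f_i] = alpha_i in g^v are extracted from the principal triple: the kernel of ad t^v is no
    larger than that of ad e^v, hence equal to h^v. Finiteness always enters in one way: non-zero
    eigenvectors whose eigenvalues form a non-constant arithmetic progression cannot go on for
    ever. *)

(** * Weight vectors and eigenvalues in arithmetic progression *)

Section Weights.
Context (k : fieldType) (V : lmodType k) (A : Type) (op : A -> {linear V -> V}).

Definition has_weight (chi : A -> k) (v : V) := forall a, op a v = chi a *: v.

Lemma has_weightZ (chi : A -> k) (c : k) (v : V) :
  has_weight chi v -> has_weight chi (c *: v).
Proof. by move=> wv a; rewrite linearZ /= wv !scalerA mulrC. Qed.

(** If [psi j] differs from [chi] at [a], then [op a - psi j a] kills the term [v j], rescales the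
    others and multiplies [u] by a non-zero scalar; this shortens the sum. *)
Lemma weight_of_sum (I : eqType) (s : seq I) (psi : I -> A -> k) (v : I -> V)
    (chi : A -> k) (u : V) :
    (forall i, has_weight (psi i) (v i)) ->
    u = \sum_(i <- s) v i -> has_weight chi u -> u != 0 ->
  exists2 i, i \in s & forall a, psi i a = chi a.
Proof.
elim: s u v => [|j s IHs] u v wv.
  by move=> ->; rewrite big_nil eqxx.
rewrite big_cons => uE wu u0.
have [eq_chi|] := classic (forall a, psi j a = chi a).
  by exists j => //; rewrite mem_head.
move=> /not_all_ex_not[a /eqP neq_chi].
have c0 : chi a - psi j a != 0 by rewrite subr_eq0 eq_sym.
have [||||i i_s eq_i] := IHs ((chi a - psi j a) *: u)
    (fun i => (psi i a - psi j a) *: v i).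
- by move=> i; apply: has_weightZ.
- rewrite scalerBl -(wu a) uE linearD /= wv scalerDr opprD addrACA subrr add0r.
  rewrite linear_sum scaler_sumr -sumrB; apply: eq_bigr => i _.
  by rewrite /= wv scalerBl.
- exact: has_weightZ.
- by rewrite scaler_eq0 negb_or c0.
- by exists i => //; rewrite inE i_s orbT.
Qed.

End Weights.

Section ArithmeticEigenvalues.
Context (k : fieldType) (V : vectType k) (F : {linear V -> V}) (a b : k).
Hypotheses (k_char0 : [pchar k] =i pred0) (b_neq0 : b != 0).

Lemma natr_inj_char0 : injective (fun n : nat => n%:R : k).
Proof.
have nat0 := (pcharf0P k).1 k_char0.
have H m n : (m <= n)%N -> m%:R = n%:R :> k -> m = n.
  move=> lemn /eqP; rewrite eq_sym -subr_eq0 -natrB // nat0 subn_eq0 => lenm.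
  by apply/eqP; rewrite eqn_leq lemn.
move=> m n; case/orP: (leq_total m n) => [le_mn|le_nm] mn; first exact: H.
by apply/esym/H.
Qed.

Lemma natr_neq0 n : (n.+1%:R : k) != 0.
Proof. by rewrite ((pcharf0P k).1 k_char0). Qed.

(** Otherwise [u 0], ..., [u (\dim {:V})] are non-zero eigenvectors for distinct eigenvalues, hence
    free, and there is one too many. *)
Lemma arithmetic_eigenvectors_vanish (u : nat -> V) :
    (forall n, F (u n) = (a + n%:R * b) *: u n) ->
    (forall n, u n = 0 -> u n.+1 = 0) ->
  u (\dim {:V}) = 0.
Proof.
move=> Fu u_stab; apply/eqP/negPn/negP => uN0.
have un0 n : (n <= \dim {:V})%N -> u n != 0.
  move=> len; apply: contraNN uN0 => /eqP un.
  rewrite -(subnKC len); elim: (_ - _)%N => [|p IHp]; first by rewrite addn0 un.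
  by rewrite addnS (u_stab _ (eqP IHp)).
pose X := [tuple u i | i < (\dim {:V}).+1].
have free_X : free X.
  apply/freeP => c; under eq_bigr do rewrite -tnth_nth tnth_mktuple.
  move=> sum0 j; apply/eqP/negPn/negP => cj0.
  have [||||i] := @weight_of_sum _ V unit (fun=> F) _
     [seq i <- index_enum 'I_(\dim {:V}).+1 | i != j]
     (fun i _ => a + i%:R * b) (fun i => - (c i *: u i))
     (fun=> a + j%:R * b) (c j *: u j).
  - by move=> i; rewrite -scaleNr; apply: has_weightZ => _; apply: Fu.
  - rewrite big_filter; apply/eqP; rewrite sumrN -addr_eq0 addrC.
    by move/eqP: sum0; rewrite (bigD1 j) //= addrC.
  - by apply: has_weightZ => _; apply: Fu.
  - by rewrite scaler_eq0 negb_or cj0 un0 // -ltnS.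
  rewrite mem_filter => /andP[/eqP neq_ij _] /(_ tt).
  by move=> /addrI /(mulIf b_neq0) /natr_inj_char0 /val_inj.
have := dimvS (subvf <<X>>%VS).
by rewrite (eqP free_X) size_tuple ltnn.
Qed.

End ArithmeticEigenvalues.

(** * Elementary bracket calculus *)

Section LieBasics.
Context (k : fieldType) (L : lieAlgType k).
Implicit Types (x y z u v : L) (c : k).

Lemma lieDl x y z : [lie x + y, z] = [lie x, z] + [lie y, z].
Proof. by rewrite -[x]scale1r lie_bracketPl !scale1r. Qed.

Lemma lie0l z : [lie 0, z] = 0.
Proof. by apply: (addrI [lie 0, z]); rewrite -lieDl !addr0. Qed.

Lemma lieZl c x z : [lie c *: x, z] = c *: [lie x, z].
Proof. by rewrite -[c *: x]addr0 lie_bracketPl lie0l addr0. Qed.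

Lemma lieNl x z : [lie - x, z] = - [lie x, z].
Proof. by rewrite -scaleN1r lieZl scaleN1r. Qed.

Lemma lie_suml (I : Type) (r : seq I) (P : pred I) (F : I -> L) z :
  [lie \sum_(i <- r | P i) F i, z] = \sum_(i <- r | P i) [lie F i, z].
Proof.
by apply: (big_morph (fun x => [lie x, z])) => [x y|]; rewrite ?lieDl ?lie0l.
Qed.

Lemma lieC x y : [lie x, y] = - [lie y, x].
Proof.
apply/eqP; rewrite -addr_eq0; apply/eqP.
have := lie_alternating (x + y).
by rewrite lieDl !linearD /= !lie_alternating add0r addr0.
Qed.

Lemma lie_derivation x y z :
  [lie x, [lie y, z]] = [lie [lie x, y], z] + [lie y, [lie x, z]].
Proof.
rewrite (lieC [lie x, y]) (lieC x z) linearN /= addrC -opprD.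
by apply/eqP; rewrite -addr_eq0 addrA lie_jacobi.
Qed.

Lemma lie_lie x y z :
  [lie [lie x, y], z] = [lie x, [lie y, z]] - [lie y, [lie x, z]].
Proof. by rewrite lie_derivation addrK. Qed.

Lemma iter_lie0 n x : iter n (lie_bracket x) 0 = 0.
Proof. by elim: n => //= n ->; rewrite linear0. Qed.

Lemma iter_lieD n x u v : iter n (lie_bracket x) (u + v)
  = iter n (lie_bracket x) u + iter n (lie_bracket x) v.
Proof. by elim: n => //= n ->; rewrite linearD. Qed.

Lemma iter_lieZ n x c v :
  iter n (lie_bracket x) (c *: v) = c *: iter n (lie_bracket x) v.
Proof. by elim: n => //= n ->; rewrite linearZ. Qed.

Lemma iter_lie_eq0 m n x v : (m <= n)%N ->
  iter m (lie_bracket x) v = 0 -> iter n (lie_bracket x) v = 0.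
Proof. by move=> lemn vm; rewrite -(subnK lemn) iterD vm iter_lie0. Qed.

Lemma iter_lie_sum n x (I : Type) (r : seq I) (P : pred I) (F : I -> L) :
  iter n (lie_bracket x) (\sum_(i <- r | P i) F i)
  = \sum_(i <- r | P i) iter n (lie_bracket x) (F i).
Proof.
by apply: (big_morph _ (iter_lieD n x)); apply: iter_lie0.
Qed.

Lemma lie_iter_weight x y a b v n :
  [lie x, y] = b *: y -> [lie x, v] = a *: v ->
  [lie x, iter n (lie_bracket y) v] = (a + n%:R * b) *: iter n (lie_bracket y) v.
Proof.
move=> xy xv; elim: n => [|n IHn] /=; first by rewrite mul0r addr0.
rewrite lie_derivation xy IHn lieZl linearZ /= -scalerDl; congr (_ *: _).
by rewrite -addn1 natrD; ring.
Qed.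

End LieBasics.

(** * Nilpotent adjoint actions and their exponentials *)

Section AdNilpotent.
Context (k : fieldType) (L : lieAlgType k).
Hypothesis k_char0 : [pchar k] =i pred0.

(* If [a, x] = 2 x, the powers of ad x are eigenvectors of the commutator with
   ad a, for pairwise distinct eigenvalues. *)
Lemma ad_nilpotent (a x : L) : [lie a, x] = 2%:R *: x ->
  exists N, forall v, iter N (lie_bracket x) v = 0.
Proof.
move=> ax; pose A := linfun (lie_bracket a); pose B := linfun (lie_bracket x).
pose F (M : 'End(L)) : 'End(L) := ((A \o M) - (M \o A))%VF.
have linF : linear F.
  move=> c M M'; apply/lfunP => v.
  by rewrite /F !(add_lfunE, opp_lfunE, comp_lfunE, scale_lfunE) linearP /=
    scalerBr opprD addrACA.
pose FL := GRing.isLinear.Build _ _ _ _ F linF.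
pose G : {linear 'End(L) -> 'End(L)} := HB.pack F FL.
pose u n : 'End(L) := iter n (comp_lfun B) \1%VF.
have uE n v : u n v = iter n (lie_bracket x) v.
  by elim: n => [|n IHn] /=; rewrite ?id_lfunE // comp_lfunE IHn lfunE.
exists (\dim {: 'End(L)}) => v; rewrite -uE.
rewrite (@arithmetic_eigenvectors_vanish _ _ G 0 2%:R k_char0) ?zero_lfunE //.
- exact: natr_neq0.
- move=> n; apply/lfunP => w.
  rewrite /= /F !(add_lfunE, opp_lfunE, comp_lfunE, scale_lfunE) !uE !lfunE /=.
  elim: n => [|n IHn] /=; first by rewrite subrr mul0r addr0 scale0r.
  rewrite lie_derivation ax lieZl -addrA -linearB IHn linearZ /= -scalerDl.
  by congr (_ *: _); rewrite -addn1 natrD; ring.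
- by move=> n un0; rewrite /u iterS -/(u n) un0 comp_lfun0r.
Qed.

End AdNilpotent.

Lemma sum_antidiagonal (V : nmodType) (T : nat -> nat -> V) (M : nat) :
  \sum_(n < M) \sum_(i < n.+1) T i (n - i)%N
  = \sum_(i < M) \sum_(j < M - i) T i j.
Proof.
elim: M => [|M IHM]; first by rewrite !big_ord0.
rewrite big_ord_recr /= IHM [in LHS]big_ord_recr [in RHS]big_ord_recr /= addrA.
congr (_ + _); last by rewrite subnn subSnn big_ord1.
rewrite -big_split; apply: eq_bigr => i _ /=.
by rewrite subSn ?(ltnW (ltn_ord i)) // big_ord_recr.
Qed.

Section AdExponential.
Context (k : fieldType) (L : lieAlgType k).
Hypothesis k_char0 : [pchar k] =i pred0.
Variables (x : L) (N : nat).
Hypothesis x_nil : forall v, iter N (lie_bracket x) v = 0.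
Implicit Types (c : k) (u v : L).

Definition ad_exp c v : L :=
  \sum_(n < N) (c ^+ n / n`!%:R) *: iter n (lie_bracket x) v.

Lemma ad_exp_trunc M c v : iter M (lie_bracket x) v = 0 ->
  ad_exp c v = \sum_(n < M) (c ^+ n / n`!%:R) *: iter n (lie_bracket x) v.
Proof.
have H a b : (a <= b)%N -> iter a (lie_bracket x) v = 0 ->
    \sum_(n < a) (c ^+ n / n`!%:R) *: iter n (lie_bracket x) v
    = \sum_(n < b) (c ^+ n / n`!%:R) *: iter n (lie_bracket x) v.
  move=> leab va; pose f n := (c ^+ n / n`!%:R) *: iter n (lie_bracket x) v.
  rewrite (big_ord_widen b f leab) big_mkcond /=.
  apply: eq_bigr => i _; case: ltnP => // leai.
  by rewrite (iter_lie_eq0 leai va) scaler0.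
by move=> vM; case: (leqP N M) => le; [|apply/esym]; apply: H => //; apply: ltnW.
Qed.

Lemma ad_exp_linear c : linear (ad_exp c).
Proof.
move=> a u v; rewrite /ad_exp scaler_sumr -big_split; apply: eq_bigr => i _ /=.
by rewrite iter_lieD iter_lieZ scalerDr !scalerA mulrC.
Qed.

(** Descent through the powers: once [(ad x)^(N-m)] kills [v], applying [(ad x)^(N-m-1)] to the
    vanishing exponential leaves only its leading term. *)
Lemma ad_exp_inj0 c v : ad_exp c v = 0 -> v = 0.
Proof.
move=> expv; suff H m : iter (N - m) (lie_bracket x) v = 0.
  by have := H N; rewrite subnn.
elim: m => [|m IHm]; first by rewrite subn0 x_nil.
case: (leqP N m) => [leNm|ltmN].
  move: IHm (leNm) (leqW leNm); rewrite -!subn_eq0 => + /eqP E1 /eqP E2.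
  by rewrite E1 E2.
have := congr1 (iter (N - m.+1) (lie_bracket x)) expv.
rewrite iter_lie0 /ad_exp iter_lie_sum; case: (N) ltmN IHm => // n ltmn IHm.
rewrite big_ord_recl /= expr0 divr1 scale1r big1 ?addr0 //.
move=> i _; rewrite iter_lieZ -iterS -iterD (@iter_lie_eq0 _ _ (n.+1 - m)) ?scaler0 //.
by rewrite subSS subSn // addnS ltnS leq_addr.
Qed.

Lemma iter_lie_leibniz n u v : iter n (lie_bracket x) [lie u, v]
  = \sum_(i < n.+1) ([lie iter i (lie_bracket x) u, iter (n - i) (lie_bracket x) v]
      *+ 'C(n, i)).
Proof.
elim: n => [|n IHn]; first by rewrite big_ord1.
pose T i j := [lie iter i (lie_bracket x) u, iter j (lie_bracket x) v].
rewrite iterS IHn linear_sum /=.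
under eq_bigr => i _ do rewrite linearMn /= lie_derivation mulrnDl -/(T i.+1 (n - i)%N)
  -/(T i (n - i).+1).
rewrite big_split /= [RHS](eq_bigr (fun i : 'I__ => T i (n.+1 - i)%N *+ 'C(n.+1, i))) //.
rewrite [RHS]big_ord_recl [X in _ + X = _]big_ord_recl /= !bin0 subn0.
rewrite addrCA; congr (_ + _).
rewrite [in RHS](eq_bigr (fun i : 'I__ => T i.+1 (n - i)%N *+ 'C(n, i.+1)
    + T i.+1 (n - i)%N *+ 'C(n, i))); last first.
  by move=> i _; rewrite -mulrnDr binS.
rewrite big_split /= addrC; congr (_ + _).
rewrite [RHS]big_ord_recr /= bin_small // mulr0n addr0.
by apply: eq_bigr => i _; rewrite /bump /= subnSK.
Qed.

Lemma ad_exp_lie c u v : ad_exp c [lie u, v] = [lie ad_exp c u, ad_exp c v].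
Proof.
pose T i j := (c ^+ i / i`!%:R * (c ^+ j / j`!%:R))
  *: [lie iter i (lie_bracket x) u, iter j (lie_bracket x) v].
have exp_bin n i : (i <= n)%N -> c ^+ n / n`!%:R * 'C(n, i)%:R
    = c ^+ i / i`!%:R * (c ^+ (n - i) / (n - i)`!%:R).
  move=> le_in; rewrite -{1}(subnKC le_in) exprD -(bin_fact le_in) !natrM.
  have nz m : (m`!%:R : k) != 0.
    by rewrite -(prednK (fact_gt0 m)) natr_neq0.
  have nzC : ('C(n, i)%:R : k) != 0.
    by rewrite -(prednK (n := 'C(n, i))) ?natr_neq0 // bin_gt0.
  by field; rewrite !nz nzC.
(* With the cut at [N + N], the inner sum of length [N + N - i] still contains all non-zero terms
   for each [i < N]. *)
have nil2 w : iter (N + N) (lie_bracket x) w = 0.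
  by rewrite (iter_lie_eq0 (leq_addl N N)).
rewrite !(ad_exp_trunc c (nil2 _)) lie_suml.
transitivity (\sum_(n < N + N) \sum_(i < n.+1) T i (n - i)%N).
  apply: eq_bigr => n _; rewrite iter_lie_leibniz scaler_sumr.
  apply: eq_bigr => i _; rewrite /T -scaler_nat scalerA.
  by congr (_ *: _); apply: exp_bin; rewrite -ltnS.
rewrite sum_antidiagonal; apply: eq_bigr => i _; rewrite lieZl.
have [leNi|ltiN] := leqP N i.
  rewrite (iter_lie_eq0 leNi) // lie0l scaler0 big1 // => j _.
  by rewrite /T (iter_lie_eq0 leNi) // lie0l scaler0.
rewrite -(ad_exp_trunc c (nil2 v)) (@ad_exp_trunc (N + N - i)); last first.
  by apply: (@iter_lie_eq0 _ _ N) => //; rewrite leq_subRL ?leq_add2r ltnW // ltn_addl.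
rewrite linear_sum scaler_sumr; apply: eq_bigr => j _.
by rewrite linearZ /= scalerA.
Qed.

Lemma ad_exp_commute c v : [lie x, v] = 0 -> ad_exp c v = v.
Proof.
move=> xv; rewrite (@ad_exp_trunc 1) // big_ord1 /= expr0.
by rewrite fact0 divr1 scale1r.
Qed.

Lemma ad_exp_cartan c s v : [lie x, v] = s *: x -> ad_exp c v = v + (c * s) *: x.
Proof.
move=> xv; rewrite (@ad_exp_trunc 2) /= ?xv; last first.
  by rewrite linearZ /= lie_alternating scaler0.
rewrite big_ord_recl big_ord1 /= expr0 expr1 fact0 !divr1 scale1r.
by rewrite xv scalerA.
Qed.

Lemma ad_exp_opposite c v t : [lie x, v] = - t -> [lie x, t] = 2%:R *: x ->
  ad_exp c v = v - c *: t - c ^+ 2 *: x.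
Proof.
move=> xv xt; have two0 : (2%:R : k) != 0 by apply: natr_neq0.
rewrite (@ad_exp_trunc 3) /=; last first.
  by rewrite xv linearN /= xt linearN linearZ /= lie_alternating scaler0 oppr0.
rewrite !big_ord_recl big_ord0 /= expr0 expr1 fact0 !divr1 scale1r addr0.
rewrite xv (linearN (lie_bracket x)) /= xt !scalerN scalerA addrA; congr (_ - _ - _ *: _).
have -> : bump 0 (bump 0 0) = 2%N by [].
have -> : (2`! = 2)%N by [].
by field.
Qed.

Lemma ad_exp_stable (Q : L -> Prop) c v :
    (forall a u w, Q u -> Q w -> Q (a *: u + w)) ->
    (forall u, Q u -> Q [lie x, u]) -> Q v ->
  Q (ad_exp c v).
Proof.
move=> Qlin Qx Qv; rewrite /ad_exp.
have Q0 : Q 0 by rewrite -(addNr v) -scaleN1r; apply: Qlin.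
elim/big_rec: _ => // i w _ Qw; apply: Qlin => //.
by elim: (val i) => //= n IHn; apply: Qx.
Qed.

End AdExponential.

(** * Lifting a reflection to an automorphism *)

Section ReflectionAutomorphism.
Context (k : fieldType) (L : lieAlgType k) (C : lmodType k).
Hypothesis k_char0 : [pchar k] =i pred0.
Variables (phi : {linear C -> L}) (chi : C -> k) (t : C) (x y : L).
Hypothesis phix : forall a, [lie phi a, x] = chi a *: x.
Hypothesis phiy : forall a, [lie phi a, y] = - chi a *: y.
Hypothesis xy : [lie x, y] = phi t.
Hypothesis chit : chi t = 2%:R.
Hypothesis chi_refl : forall a, chi (a - chi a *: t) = - chi a.

Lemma striple_ad_nilpotent : exists N,
  (forall v, iter N (lie_bracket x) v = 0) /\
  (forall v, iter N (lie_bracket y) v = 0).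
Proof.
have [|N xN] := @ad_nilpotent _ _ k_char0 (phi t) x; first by rewrite phix chit.
have [|M yM] := @ad_nilpotent _ _ k_char0 (- phi t) y.
  by rewrite lieNl phiy chit scaleNr opprK.
exists (N + M)%N; split=> v.
  exact: iter_lie_eq0 (leq_addr _ _) (xN v).
exact: iter_lie_eq0 (leq_addl _ _) (yM v).
Qed.

(** The witness exp(ad x) exp(-ad y) exp(ad x) is the usual lift of a reflection from SL_2. The last
    clause carries subspaces given by predicates through [theta] without exposing the
    exponentials. *)
Lemma reflection_automorphism : exists theta : L -> L,
  [/\ linear theta, forall v, theta v = 0 -> v = 0,
      forall u v, theta [lie u, v] = [lie theta u, theta v],
      forall a, theta (phi a) = phi (a - chi a *: t)
    & forall (Q : L -> Prop) v,
        (forall a u w, Q u -> Q w -> Q (a *: u + w)) ->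
        (forall u, Q u -> Q [lie x, u]) -> (forall u, Q u -> Q [lie y, u]) ->
        Q v -> Q (theta v)].
Proof.
have [N [xN yN]] := striple_ad_nilpotent.
exists (ad_exp x N 1 \o ad_exp y N (- 1) \o ad_exp x N 1); split=> /=.
- by move=> c u v; rewrite /= !ad_exp_linear.
- move=> v /(ad_exp_inj0 xN) /(ad_exp_inj0 yN).
  exact: (ad_exp_inj0 xN).
- by move=> u v; rewrite !ad_exp_lie.
- move=> a; have xphi b : [lie x, phi b] = - chi b *: x.
    by rewrite lieC phix scaleNr.
  have yphi b : [lie y, phi b] = chi b *: y by rewrite lieC phiy scaleNr opprK.
  rewrite (ad_exp_cartan xN _ (xphi a)) mul1r addrC ad_exp_linear.
  rewrite (ad_exp_cartan yN _ (yphi a)).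
  have yx : [lie y, x] = - phi t by rewrite lieC xy.
  have yt : [lie y, phi t] = 2%:R *: y by rewrite yphi chit.
  rewrite (ad_exp_opposite k_char0 yN _ yx yt).
  rewrite expr2 mulrNN !mul1r !scale1r !scaleN1r opprK mulN1r.
  have -> : - chi a *: (x + phi t - y) + (phi a + - chi a *: y)
     = - chi a *: x + phi (a - chi a *: t).
    have -> : phi (a - chi a *: t) = phi a - chi a *: phi t by rewrite linearB linearZ.
    rewrite scalerBr scalerDr addrACA addNr addr0 -addrA.
    by congr (_ + _); rewrite addrC scaleNr.
  rewrite ad_exp_linear (ad_exp_commute xN) ?lie_alternating //.
  rewrite (ad_exp_cartan xN _ (xphi _)).
  rewrite mul1r addrCA -scalerDl; set d := - chi a - _.
  have -> : d = 0 by rewrite /d chi_refl opprK addNr.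
  by rewrite scale0r addr0.
- move=> Q v Qlin Qx Qy Qv.
  by do 3! [apply: ad_exp_stable => //].
Qed.

End ReflectionAutomorphism.

(** * The subspace spanned by the Cartan subalgebra and the positive root vectors *)

Section PositivePart.
Context (k : fieldType) (V : lieAlgType k) (H : vectType k) (l : nat).
Hypothesis k_char0 : [pchar k] =i pred0.
Variables (phi : {linear H -> V}) (x y : 'I_l -> V) (alpha : 'I_l -> H).
Variables (hc : 'I_l -> 'Hom(H, k^o)) (rho : H).
Hypothesis phi_inj : forall lam, phi lam = 0 -> lam = 0.
Hypothesis phiC : forall lam mu, [lie phi lam, phi mu] = 0.
Hypothesis phix : forall lam i, [lie phi lam, x i] = (hc i lam : k) *: x i.
Hypothesis phiy : forall lam i, [lie phi lam, y i] = - (hc i lam : k) *: y i.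
Hypothesis xy : forall i, [lie x i, y i] = phi (alpha i).
Hypothesis xy0 : forall i j, i != j -> [lie x i, y j] = 0.
Hypothesis hc_alpha : forall i, hc i (alpha i) = 2%:R.
Hypothesis hc_rho : forall i, hc i rho = 1.

Local Notation covector := 'Hom(H, k^o).
Local Notation weight t v := (has_weight (fun lam => lie_bracket (phi lam))
  (fun lam => (t lam : k)) v).
Local Notation e := (\sum_i x i).

Definition word (s : seq 'I_l) (lam : H) : V :=
  foldr (fun i v => [lie x i, v]) (phi lam) s.

Definition wordwt (s : seq 'I_l) : covector := \sum_(i <- s) hc i.

(** This is U. Scalars are absorbed by the Cartan element at the end of each word ([wordZ]), so
    plain sums of words already form a subspace. *)
Definition in_pos (v : V) :=
  exists ws : seq (seq 'I_l * H), v = \sum_(p <- ws) word p.1 p.2.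

Lemma wordwt_nil : wordwt [::] = 0.
Proof. by rewrite /wordwt big_nil. Qed.

Lemma wordwt_cons i s : wordwt (i :: s) = hc i + wordwt s.
Proof. by rewrite /wordwt big_cons. Qed.

Lemma wordwt_rho s : wordwt s rho = (size s)%:R :> k.
Proof.
elim: s => [|i s IHs]; first by rewrite wordwt_nil zero_lfunE.
by rewrite wordwt_cons add_lfunE hc_rho IHs /= -natr1 addrC.
Qed.

Lemma word_weight s mu : weight (wordwt s) (word s mu).
Proof.
move=> lam /=; elim: s => [|i s IHs] /=.
  by rewrite wordwt_nil zero_lfunE scale0r phiC.
by rewrite lie_derivation phix IHs lieZl linearZ /= -scalerDl wordwt_cons add_lfunE.
Qed.

Lemma wordZ s c lam : word s (c *: lam) = c *: word s lam.
Proof. by elim: s => [|i s /= ->]; rewrite /= linearZ. Qed.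

Lemma in_pos_word s lam : in_pos (word s lam).
Proof. by exists [:: (s, lam)]; rewrite big_seq1. Qed.

Lemma in_pos_phi lam : in_pos (phi lam).
Proof. exact: in_pos_word [::] lam. Qed.

Lemma in_pos_lin c u v : in_pos u -> in_pos v -> in_pos (c *: u + v).
Proof.
move=> [us ->] [vs ->]; exists ([seq (p.1, c *: p.2) | p <- us] ++ vs).
rewrite big_cat big_map scaler_sumr; congr (_ + _).
by apply: eq_bigr => p _; rewrite wordZ.
Qed.

Lemma in_pos0 : in_pos 0.
Proof. by exists [::]; rewrite big_nil. Qed.

Lemma in_posD u v : in_pos u -> in_pos v -> in_pos (u + v).
Proof. by move=> pu pv; rewrite -[u]scale1r; apply: in_pos_lin. Qed.

Lemma in_posZ c u : in_pos u -> in_pos (c *: u).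
Proof. by move=> pu; rewrite -[_ *: _]addr0; apply: in_pos_lin in_pos0. Qed.

Lemma in_pos_sum (I : Type) (r : seq I) (F : I -> V) :
  (forall i, in_pos (F i)) -> in_pos (\sum_(i <- r) F i).
Proof. by move=> pF; elim/big_rec: _ => [|i v _]; [apply: in_pos0|apply: in_posD]. Qed.

Lemma in_pos_x i v : in_pos v -> in_pos [lie x i, v].
Proof.
move=> [ws ->]; exists [seq (i :: p.1, p.2) | p <- ws].
by rewrite big_map linear_sum.
Qed.

Lemma in_pos_cartan lam v : in_pos v -> in_pos [lie phi lam, v].
Proof.
move=> [ws ->]; rewrite linear_sum; apply: in_pos_sum => p /=.
by rewrite (word_weight p.1 p.2 lam); apply/in_posZ/in_pos_word.
Qed.

Lemma in_pos_e v : in_pos v -> in_pos [lie e, v].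
Proof. by move=> pv; rewrite lie_suml; apply: in_pos_sum => i; apply: in_pos_x. Qed.

(* The span of the positive part and y k is stable under both x k and y k. *)
Definition in_minpar k v := exists u a, in_pos u /\ v = u + a *: y k.

Lemma in_minpar_pos i v : in_pos v -> in_minpar i v.
Proof. by move=> pv; exists v, 0; rewrite scale0r addr0. Qed.

Lemma in_minpar_lin i c u v :
  in_minpar i u -> in_minpar i v -> in_minpar i (c *: u + v).
Proof.
move=> [u' [a [pu ->]]] [v' [b [pv ->]]]; exists (c *: u' + v'), (c * a + b).
by split; [apply: in_pos_lin|rewrite scalerDr scalerA addrACA -scalerDl].
Qed.

Lemma in_minpar0 i : in_minpar i 0.
Proof. exact/in_minpar_pos/in_pos0. Qed.

Lemma in_minparD i u v : in_minpar i u -> in_minpar i v -> in_minpar i (u + v).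
Proof. by move=> pu pv; rewrite -[u]scale1r; apply: in_minpar_lin. Qed.

Lemma in_minpar_x i v : in_minpar i v -> in_minpar i [lie x i, v].
Proof.
move=> [u [a [pu ->]]]; apply: in_minpar_pos; rewrite linearD linearZ /= xy.
by apply: in_posD (in_posZ _ (in_pos_phi _)); apply: in_pos_x.
Qed.

(** [y i] passes each [x j] as a derivation. A multiple of [y i] arises only at the Cartan end of
    the word, and the next [x j] turns it into 0 or a multiple of [phi (alpha i)]. *)
Lemma y_word i s lam : in_minpar i [lie y i, word s lam].
Proof.
elim: s => [|j s IHs] /=.
  exists 0, (hc i lam : k); split; first exact: in_pos0.
  by rewrite lieC phiy scaleNr opprK add0r.
rewrite lie_derivation; apply: in_minparD.
  apply: in_minpar_pos; rewrite (lieC (y i)) lieNl -scaleN1r; apply: in_posZ.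
  have [->|neq_ij] := eqVneq j i; last by rewrite (xy0 neq_ij) lie0l; apply: in_pos0.
  by rewrite xy; apply/in_pos_cartan/in_pos_word.
have [u [a [pu ->]]] := IHs; rewrite linearD linearZ /=.
have [->|neq_ij] := eqVneq j i.
  rewrite xy; apply: in_minpar_pos.
  by apply: in_posD; [apply: in_pos_x|apply/in_posZ/in_pos_phi].
rewrite (xy0 neq_ij) scaler0 addr0.
by apply/in_minpar_pos/in_pos_x.
Qed.

Lemma in_minpar_y i v : in_minpar i v -> in_minpar i [lie y i, v].
Proof.
move=> [u [a [[ws ->] ->]]].
rewrite linearD linearZ /= lie_alternating scaler0 addr0 linear_sum.
elim/big_rec: _ => [|p w _]; first exact: in_minpar0.
exact/in_minparD/y_word.
Qed.

Lemma pos_weight_word (t : H -> k) v :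
    in_pos v -> v != 0 -> has_weight (fun lam => lie_bracket (phi lam)) t v ->
  exists s, (exists lam, word s lam != 0) /\ forall lam, (wordwt s lam : k) = t lam.
Proof.
move=> [ws vE] v0 wv.
have [||||p] := @weight_of_sum _ _ H (fun lam => lie_bracket (phi lam)) _
  [seq p <- ws | word p.1 p.2 != 0] (fun p lam => wordwt p.1 lam : k)
  (fun p => word p.1 p.2) t v.
- by move=> p; apply: word_weight.
- rewrite vE big_filter [RHS]big_mkcond; apply: eq_bigr => p _ /=.
  by case: eqP.
- exact: wv.
- exact: v0.
rewrite mem_filter => /andP[p0 _] tE; exists p.1; split=> //.
by exists p.2.
Qed.

Lemma y_neq0 i : y i != 0.
Proof.
apply/eqP => yi0; have := xy i; rewrite yi0 linear0 => /esym/phi_inj a0.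
have := hc_alpha i; rewrite a0 linear0 => /esym/eqP.
by rewrite (negPf (natr_neq0 k_char0 1)).
Qed.

(** At [rho] the weight of a word is its length, whereas that of [y i] is -1. *)
Lemma in_pos_y i a : in_pos (a *: y i) -> a = 0.
Proof.
move=> pay; apply/eqP/negPn/negP => a0.
have [||s [_]] := @pos_weight_word (fun lam => - (hc i lam : k)) _ pay.
- by rewrite scaler_eq0 negb_or a0 y_neq0.
- by apply: has_weightZ => lam /=; apply: phiy.
move/(_ rho)/eqP; rewrite wordwt_rho hc_rho -addr_eq0 natr1.
by rewrite (negPf (natr_neq0 k_char0 _)).
Qed.

Lemma word_nilpotent s lam : (\dim {:V} <= size s)%N -> word s lam = 0.
Proof.
case Es: s => [|i0 s'].
  rewrite leqn0 dimv_eq0 => /eqP V0; apply/eqP; rewrite -memv0 -V0.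
  exact: memvf.
(* The word is read from its innermost letter, so that [u n.+1] is a bracket with [u n]. The default
   [i0] enters only beyond the length of [s]. *)
rewrite -Es; pose f := nth i0 (rev s).
have wordE : s = rev (mkseq f (size s)).
  by rewrite /f -(size_rev s) mkseq_nth revK.
pose u n := word (rev (mkseq f n)) lam.
have u_stab n : u n = 0 -> u n.+1 = 0.
  by rewrite /u /mkseq -addn1 iotaD map_cat rev_cat /= => ->; rewrite linear0.
have uN : u (\dim {:V}) = 0.
  apply: (@arithmetic_eigenvectors_vanish _ _ (lie_bracket (phi rho)) 0 1) => //.
    exact: oner_neq0.
  move=> n; rewrite (word_weight _ _ rho) /= wordwt_rho size_rev size_mkseq.
  by rewrite add0r mulr1.
move=> le; rewrite wordE -/(u _) -(subnK le) addnC.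
elim: (_ - _)%N => [|n IHn]; first by rewrite addn0.
by rewrite addnS; apply: u_stab.
Qed.

Definition pos_root (t : covector) :=
  t != 0 /\ exists2 u, in_pos u & u != 0 /\ weight t u.

Lemma pos_root_word t : pos_root t ->
  exists s, [/\ t = wordwt s, s != [::] & (size s < \dim {:V})%N].
Proof.
move=> [t0 [u pu [u0 wu]]]; have [s [[lam s0] sE]] := pos_weight_word pu u0 wu.
have tE : t = wordwt s by apply/lfunP => mu; rewrite -sE.
exists s; split=> //.
  by apply: contraNneq t0 => s_nil; rewrite tE s_nil wordwt_nil.
by rewrite ltnNge; apply: contra s0 => /word_nilpotent ->.
Qed.

Lemma pos_root_height t : pos_root t -> exists n, t rho = n.+1%:R :> k.
Proof.
by move=> /pos_root_word[[|i s] [-> // _ _]]; exists (size s); rewrite wordwt_rho.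
Qed.

Lemma pos_root_oppN t : pos_root t -> ~ pos_root (- t).
Proof.
move=> /pos_root_height[m tm] /pos_root_height[n].
rewrite opp_lfunE tm => /eqP; rewrite eq_sym -addr_eq0 -natrD addnS.
by rewrite (negPf (natr_neq0 k_char0 _)).
Qed.

Lemma x_neq0 i : x i != 0.
Proof.
apply/eqP => xi0; have := xy i; rewrite xi0 lie0l => /esym/phi_inj a0.
have := hc_alpha i; rewrite a0 linear0 => /esym/eqP.
by rewrite (negPf (natr_neq0 k_char0 1)).
Qed.

Lemma pos_root_simple i : pos_root (hc i).
Proof.
split.
  apply/eqP => h0; have := hc_rho i; rewrite h0 zero_lfunE => /esym/eqP.
  by rewrite oner_eq0.
(* This multiple of [x i] is the word [[lie x i, phi (alpha i)]], which shows that it lies in U. *)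
exists (- 2%:R *: x i); last first.
  split; last by apply: has_weightZ => lam; apply: phix.
  by rewrite scaler_eq0 oppr_eq0 (negPf (natr_neq0 k_char0 1)) x_neq0.
have := in_pos_x i (in_pos_phi (alpha i)).
by rewrite lieC phix hc_alpha scaleNr.
Qed.

Definition srefl i (lam : H) : H := lam - (hc i lam : k) *: alpha i.
Definition crefl i (t : covector) : covector := t - (t (alpha i) : k) *: hc i.

Lemma creflE i t lam : crefl i t lam = t (srefl i lam).
Proof.
have -> : t (srefl i lam) = t lam - (hc i lam : k) *: t (alpha i).
  by rewrite /srefl linearB linearZ.
rewrite /crefl add_lfunE opp_lfunE scale_lfunE; congr (_ - _).
exact: mulrC.
Qed.

Lemma hc_srefl i lam : hc i (srefl i lam) = - hc i lam.
Proof.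
have -> : hc i (srefl i lam) = hc i lam - (hc i lam : k) *: hc i (alpha i).
  by rewrite /srefl linearB linearZ.
by rewrite hc_alpha; change (hc i lam - (hc i lam : k) * 2 = - (hc i lam : k)); ring.
Qed.

Lemma sreflK i : involutive (srefl i).
Proof. by move=> lam; rewrite {1}/srefl hc_srefl /srefl scaleNr opprK subrK. Qed.

Lemma creflN i t : crefl i (- t) = - crefl i t.
Proof. by rewrite /crefl opp_lfunE scaleNr -opprD. Qed.

Lemma crefl_simple i : crefl i (hc i) = - hc i.
Proof. by apply/lfunP => lam; rewrite creflE hc_srefl opp_lfunE. Qed.

Lemma creflK i : involutive (crefl i).
Proof. by move=> t; apply/lfunP => lam; rewrite !creflE sreflK. Qed.

(* The automorphism lifting the reflection preserves the positive part extended
   by the opposite simple root vector, whose only negative weight is - hc i. *)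
Lemma pos_root_refl i t : pos_root t -> t != hc i -> pos_root (crefl i t).
Proof.
move=> [t0 [u pu [u0 wu]]] neq_t.
have [theta [lin_th th0 thB thphi thQ]] :=
  reflection_automorphism k_char0 (phix^~ i) (phiy^~ i) (xy i) (hc_alpha i)
    (hc_srefl i).
have thZ c v : theta (c *: v) = c *: theta v.
  have z0 : theta 0 = 0 by have := lin_th (-1) u u; rewrite !scaleN1r !addNr.
  by have := lin_th c v 0; rewrite !addr0 z0 addr0.
have w_th : weight (crefl i t) (theta u).
  move=> lam /=; rewrite creflE -{1}(sreflK i lam) -thphi -thB.
  by rewrite (wu (srefl i lam)) thZ.
have [u' [a [pu' uE]]] : in_minpar i (theta u).
  apply: thQ; last exact: in_minpar_pos.
  - exact: in_minpar_lin.
  - exact: in_minpar_x.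
  - exact: in_minpar_y.
have t'0 : crefl i t != 0.
  apply: contraNneq t0 => t'0.
  by rewrite -(creflK i t) t'0 /crefl zero_lfunE scale0r subr0.
have [a0|a0] := eqVneq a 0.
  split=> //; exists u'; first exact: pu'.
  move: uE; rewrite a0 scale0r addr0 => <-; split=> //.
  by apply: contra_neq u0 => /th0.
case/negP: neq_t; rewrite -(inj_eq (can_inj (creflK i))) crefl_simple.
apply/eqP/lfunP => lam.
apply/eqP; rewrite -subr_eq0; apply/eqP.
(* [theta u] has weight [crefl i t] but its [y i]-component has weight [- hc i]; the difference [c]
   puts [c * a *: y i] into U, which forces [c = 0]. *)
pose c : k := (crefl i t lam : k) - (- hc i) lam; rewrite -/c.
have : in_pos (c * a *: y i).
  have -> : c * a *: y i = [lie phi lam, u'] - (crefl i t lam : k) *: u'.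
    have := w_th lam; rewrite /= uE linearD linearZ /= phiy scalerDr => /eqP.
    rewrite -subr_eq0 opprD addrACA addr_eq0 => /eqP ->.
    rewrite opprB !scalerA -scalerBl; congr (_ *: _).
    rewrite /c opp_lfunE; change ((crefl i t lam - - (hc i lam : k)) * a
      = (crefl i t lam : k) * a - a * - (hc i lam : k)).
    by ring.
  by rewrite -scaleNr addrC; apply: in_pos_lin => //; apply: in_pos_cartan.
by move/in_pos_y/eqP; rewrite mulf_eq0 (negPf a0) orbF => /eqP.
Qed.

(** Every positive root is the weight of a word shorter than [\dim {:V}], which leaves finitely many
    candidates; they are filtered by excluded middle. *)
Lemma finite_pos_roots :
  exists S : seq covector, uniq S /\ forall t, t \in S <-> pos_root t.
Proof.
pose S0 := flatten [seq codom (fun s : n.-tuple 'I_l => wordwt s)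
  | n <- iota 0 (\dim {:V})].
have S0P t : pos_root t -> t \in S0.
  move=> /pos_root_word[s [-> _ lts]]; apply/flatten_mapP; exists (size s).
    by rewrite mem_iota.
  by apply/codomP; exists (in_tuple s).
have [S [uS SP]] : exists S : seq covector,
    uniq S /\ forall t, t \in S <-> t \in S0 /\ pos_root t.
  elim: (S0) => [|t0 S' [S [uS IHS]]]; first by exists [::]; split=> // t; split=> [|[]].
  have [tS|tS] := boolP (t0 \in S).
    exists S; split=> // t; rewrite IHS inE; split=> [[-> rt]|[/orP[/eqP->|]]] //.
    + by rewrite orbT.
    + by move=> _; apply/IHS.
  have [rt0|rt0] := classic (pos_root t0).
    exists (t0 :: S); split=> [|t]; first by rewrite /= tS.
    rewrite !inE; split=> [/orP[/eqP->|/IHS[-> ?]]|[/orP[->|tS'] rt]] //.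
    + by rewrite eqxx.
    + by rewrite orbT.
    + by apply/orP; right; apply/IHS.
  exists S; split=> // t; rewrite IHS inE.
  split=> [[-> rt]|[/orP[/eqP->|]]] //; first by rewrite orbT.
exists S; split=> // t; rewrite SP; split=> [[]|rt] //.
by split=> //; apply: S0P.
Qed.

(** * The equation u + [lam + e, u] = G lam *)

Section Solvable.
Variable G : H -> H.
Hypothesis G_refl : forall i lam,
  ((hc i lam : k) + 1) *: (G lam - G (srefl i lam))
  = ((hc i lam : k) * hc i (G lam)) *: alpha i.

Definition solvable lam :=
  exists2 u, in_pos u & u + [lie phi lam + e, u] = phi (G lam).

(* Apply exp(c ad (y i)) with c = hc i lam to a solution at lam: it maps
   phi lam + e to phi (srefl i lam) + e, and the y i-component it creates can be
   dropped. *)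
Lemma solvable_srefl i lam : solvable lam -> (hc i lam : k) != - 1 ->
  solvable (srefl i lam).
Proof.
move=> [u pu uE] c1; set c : k := hc i lam in c1.
have [N [_ yN]] := striple_ad_nilpotent k_char0 (phix^~ i) (phiy^~ i) (hc_alpha i).
pose E := ad_exp (y i) N c.
have yphi mu : [lie y i, phi mu] = (hc i mu : k) *: y i.
  by rewrite lieC phiy scaleNr opprK.
have EB v w : E (v + w) = E v + E w.
  by have := ad_exp_linear (y i) N c 1 v w; rewrite !scale1r.
have EL v w : E [lie v, w] = [lie E v, E w] by apply: ad_exp_lie.
have Ex : E e = e - c *: phi (alpha i) - c ^+ 2 *: y i.
  have yx : [lie y i, x i] = - phi (alpha i) by rewrite lieC xy.
  have yt : [lie y i, phi (alpha i)] = 2%:R *: y i by rewrite yphi hc_alpha.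
  rewrite (bigD1 i) //= EB {1}/E (ad_exp_opposite k_char0 yN c yx yt).
  have -> : E (\sum_(j < l | j != i) x j) = \sum_(j < l | j != i) x j.
    apply: (ad_exp_commute yN); rewrite linear_sum big1 //= => j neq_ji.
    by rewrite lieC xy0 ?oppr0.
  by rewrite addrAC (addrAC (x i)).
have Ephi mu : E (phi mu) = phi mu + (c * hc i mu) *: y i.
  exact: (ad_exp_cartan yN c (yphi mu)).
have phis : phi (srefl i lam) = phi lam - c *: phi (alpha i).
  by rewrite /srefl linearB linearZ.
have EM : E (phi lam + e) = phi (srefl i lam) + e.
  rewrite EB Ephi Ex phis.
  by rewrite expr2 addrACA subrr addr0 addrA addrAC.
have [u' [a [pu' EuE]]] : in_minpar i (E u).
  apply: ad_exp_stable; last exact: in_minpar_pos.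
  - exact: in_minpar_lin.
  - exact: in_minpar_y.
set M := phi (srefl i lam) + e in EM.
pose b : k := c * hc i (G lam) - a * (c + 1).
have yM : [lie M, y i] = c *: y i + phi (alpha i).
  rewrite lieDl phiy hc_srefl opprK lie_suml (bigD1 i) //= xy big1 ?addr0 //.
  by move=> j neq_ji; apply: xy0.
have eqn : u' + [lie M, u'] - phi (G lam) + a *: phi (alpha i) = b *: y i.
  have := congr1 E uE; rewrite EB Ephi EL EM EuE.
  rewrite linearD linearZ /= yM => uE'.
  rewrite /b scalerBl; have -> := canRL (addKr _) (esym uE').
  rewrite mulrDr mulr1 scalerDl scalerDr scalerA [in RHS]addrACA.
  rewrite (addrA (a *: y i)) (addrC (a *: y i)) (addrCA (u' + _)).
  by rewrite (addrCA (- phi (G lam))) [RHS]addrAC subrr add0r addrAC addrC.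
have b0 : b = 0.
  apply: (@in_pos_y i); rewrite -eqn.
  apply: in_posD (in_posZ _ (in_pos_phi _)); rewrite -scaleN1r addrC.
  apply: in_pos_lin; first exact: in_pos_phi.
  apply: in_posD => //; rewrite lieDl.
  by apply: in_posD; [apply: in_pos_cartan|apply: in_pos_e].
exists u' => //; rewrite -/M.
(* [b = 0] reads [a * (c + 1) = c * hc i (G lam)], so dividing the relation for [G] by [c + 1] shows
   that [a *: alpha i] is exactly the jump of [G]. *)
have -> : G (srefl i lam) = G lam - a *: alpha i.
  have c10 : c + 1 != 0 by rewrite addr_eq0.
  apply/eqP; rewrite -subr_eq0 opprB addrCA -[_ - _]opprB subr_eq0; apply/eqP.
  apply: (scalerI c10); rewrite (G_refl i lam) scalerA; congr (_ *: _).
  by apply/esym/eqP; rewrite -/c [X in _ == X]mulrC -subr_eq0; apply/eqP/b0.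
have -> : phi (G lam - a *: alpha i) = phi (G lam) - a *: phi (alpha i).
  by rewrite linearB linearZ.
apply/(canRL (addrK _))/eqP.
by move: eqn; rewrite b0 scale0r addrAC => /eqP; rewrite subr_eq0.
Qed.

Lemma solvable_dominant lam :
  (forall s, 1 + (wordwt s lam : k) != 0) -> solvable lam.
Proof.
move=> nz; pose im v := exists2 u, in_pos u & u + [lie phi lam + e, u] = v.
have imB c v w : im v -> im w -> im (c *: v - w).
  move=> [u pu <-] [u' pu' <-]; exists (c *: u - u').
    by apply: in_pos_lin => //; rewrite -scaleN1r; apply: in_posZ.
  by rewrite linearB linearZ /= scalerDr opprD addrACA.
have im0 : im 0 by exists 0; rewrite ?linear0 ?addr0 //; apply: in_pos0.
have imsum (F : 'I_l -> V) : (forall i, im (F i)) -> im (\sum_i F i).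
  move=> imF; elim/big_rec: _ => // i v _ imv.
  have := imB 1 _ _ (imF i) (imB 0 _ _ im0 imv).
  by rewrite scale1r scaler0 sub0r opprK.
suff imw n s mu : (\dim {:V} <= size s + n)%N -> im (word s mu).
  by apply: (imw (\dim {:V}) [::]); rewrite add0n.
elim: n s mu => [|n IHn] s mu.
  by rewrite addn0 => /word_nilpotent ->.
move=> les; pose c : k := 1 + wordwt s lam.
(* Back substitution: the operator multiplies a word by [c] up to words one letter longer, and
   sufficiently long words vanish. *)
have -> : word s mu = c^-1 *: (word s mu + [lie phi lam + e, word s mu])
    - \sum_i word (i :: s) (c^-1 *: mu).
  rewrite lieDl (word_weight s mu lam) addrA -[X in X + _ + _]scale1r -scalerDl.
  rewrite scalerDr scalerA mulVf ?nz // scale1r lie_suml scaler_sumr.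
  under [in X in _ - X]eq_bigr do rewrite wordZ.
  by rewrite addrK.
apply: imB; first by exists (word s mu) => //; apply: in_pos_word.
by apply: imsum => i; apply: IHn; rewrite /= addSnnS.
Qed.

(** [crefl i] permutes the positive roots other than [hc i] and negates [hc i], so only [hc i] makes
    a difference between the counts. *)
Lemma count_crefl_pos_roots i (S : seq covector) (p : pred covector) :
    uniq S -> (forall t, t \in S <-> pos_root t) -> p (hc i) -> ~~ p (- hc i) ->
  (count (p \o crefl i) S < count p S)%N.
Proof.
move=> uS SP phi_i pNi.
have iS : hc i \in S by apply/SP/pos_root_simple.
pose S' := rem (hc i) S.
have S'P t : t \in S' = (t != hc i) && (t \in S) by rewrite mem_rem_uniq // inE.
have permS' : perm_eq (map (crefl i) S') S'.
  apply: uniq_perm; rewrite ?map_inj_uniq ?rem_uniq //.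
    exact/can_inj/creflK.
  have sub t : t \in S' -> crefl i t \in S'.
    rewrite !S'P => /andP[neq_t /SP rt].
    apply/andP; split; last exact/SP/pos_root_refl.
    apply/eqP => eq_t; apply: (pos_root_oppN rt).
    by rewrite -(creflK i t) eq_t crefl_simple opprK; apply: pos_root_simple.
  move=> t; apply/mapP/idP => [[t' /sub ? ->] //|tS'].
  by exists (crefl i t); rewrite ?creflK // sub.
rewrite !(permP (perm_to_rem iS)) /= -/S' phi_i crefl_simple (negPf pNi) add0n.
by rewrite -count_map (permP permS').
Qed.

(* The induction climbs from the antidominant chamber to the dominant one: lam is
   - c (rho o sigma) for a Weyl group element sigma, and each simple reflection
   lowers the number of positive roots that sigma keeps positive. *)
Lemma solvable_antidominant j : solvable (- j.+1%:R^-1 *: rho).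
Proof.
have [S [uS SP]] := finite_pos_roots.
pose c : k := j.+1%:R^-1.
have c0 : c != 0 by rewrite invr_eq0 natr_neq0.
(* Here every [- sigma (hc i)] is a positive root, so a word takes at [lam] a value [n%:R * c], and
   the diagonal entry [1 + n%:R * c] is non-zero. *)
have base (sigma : covector -> covector) lam :
    (forall t, t \in S -> sigma t \in S \/ - sigma t \in S) ->
    (forall t : covector, t lam = - (c * sigma t rho) :> k) ->
    (forall i, sigma (hc i) \notin S) ->
  solvable lam.
  move=> sigS lamE negS; apply: solvable_dominant => s.
  have [n ->] : exists n : nat, wordwt s lam = n%:R * c :> k.
    elim: s => [|i s [n IHs]]; first by exists 0%N; rewrite wordwt_nil zero_lfunE mul0r.
    have [|Ni] := sigS (hc i) ((SP _).2 (pos_root_simple i)).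
      by rewrite (negPf (negS i)).
    have [m] := pos_root_height ((SP _).1 Ni); rewrite opp_lfunE => hm.
    exists (m.+1 + n)%N; rewrite wordwt_cons add_lfunE IHs lamE natrD mulrDl.
    by congr (_ + _); rewrite -hm mulNr mulrC.
  have -> : 1 + n%:R * c = (j.+1 + n)%:R * c.
    by rewrite natrD mulrDl mulfV // natr_neq0.
  by rewrite mulf_neq0 // addSn natr_neq0.
suff main n (sigma : covector -> covector) lam :
    (count (fun t => sigma t \in S) S < n)%N ->
    (forall t, sigma (- t) = - sigma t) ->
    (forall t, t \in S -> sigma t \in S \/ - sigma t \in S) ->
    (forall t : covector, t lam = - (c * sigma t rho) :> k) ->
  solvable lam.
- apply: (main _ id _ (leqnn _)) => // [t|t]; first by left.
  by rewrite linearZ; apply: mulNr.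
elim: n sigma lam => // n IHn sigma lam lt_n sigN sigS lamE.
have [[i iS]|no_i] := classic (exists i, sigma (hc i) \in S); last first.
  by apply: (base sigma) => // i; apply/negP => iS; apply: no_i; exists i.
have [m hm] := pos_root_height ((SP _).1 iS).
rewrite -(sreflK i lam); apply: solvable_srefl.
  apply: (IHn (sigma \o crefl i)) => [|t|t tS|t] /=.
  - rewrite -ltnS (leq_trans _ lt_n) // ltnS.
    apply: (@count_crefl_pos_roots i S (fun t => sigma t \in S)) => //.
    rewrite sigN; apply/negP => /SP; apply: pos_root_oppN; exact/SP.
  - by rewrite creflN sigN.
  - have [->|neq_t] := eqVneq t (hc i).
      by rewrite crefl_simple sigN opprK; right.
    by apply: sigS; apply/SP/pos_root_refl => //; apply/SP.
  - by rewrite -creflE lamE.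
rewrite hc_srefl lamE opprK hm -addr_eq0.
have -> : c * m.+1%:R + 1 = c * (m.+1 + j.+1)%:R.
  by rewrite natrD mulrDr mulVf // natr_neq0.
by rewrite mulf_neq0 // addSn natr_neq0.
Qed.

Lemma graded_sum0 (Z : nat -> V) M :
    (forall n, [lie phi rho, Z n] = n%:R *: Z n) -> \sum_(n < M) Z n = 0 ->
  forall n, (n < M)%N -> Z n = 0.
Proof.
move=> wZ sum0 n ltnM; apply/eqP/negPn/negP => Zn0.
pose n' := Ordinal ltnM.
have [||||i] := @weight_of_sum _ V unit (fun=> lie_bracket (phi rho)) _
  [seq i <- index_enum 'I_M | i != n'] (fun i _ => (i : nat)%:R)
  (fun i => - Z i) (fun=> n%:R) (Z n).
- by move=> i _; rewrite /= linearN /= wZ scalerN.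
- rewrite big_filter; apply/eqP; rewrite sumrN -addr_eq0.
  by move/eqP: sum0; rewrite (bigD1 n').
- by move=> _; apply: wZ.
- exact: Zn0.
rewrite mem_filter => /andP[/eqP neq_in _] /(_ tt) /(natr_inj_char0 k_char0) eq_in.
by apply: neq_in; apply: val_inj.
Qed.

(** [Z n] collects the words of length [n]. All large [m] are allowed because the sum is later cut
    at two consecutive lengths. *)
Lemma in_pos_graded u : in_pos u -> exists (Z : nat -> V) (M : nat),
  (forall n, [lie phi rho, Z n] = n%:R *: Z n) /\
  (forall m, (M <= m)%N -> u = \sum_(n < m) Z n).
Proof.
move=> [ws ->]; elim: ws => [|[s lam] ws [Z [M [wZ ZE]]]].
  exists (fun=> 0), 0%N; split=> [n|m _]; first by rewrite linear0 scaler0.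
  by rewrite big_nil big1.
exists (fun n => (if n == size s then word s lam else 0) + Z n), (maxn M (size s).+1).
split=> [n|m].
  rewrite linearD /= wZ scalerDr; congr (_ + _); case: eqP => [->|_].
    by rewrite (word_weight s lam rho) wordwt_rho.
  by rewrite linear0 scaler0.
rewrite geq_max => /andP[leM lts]; rewrite big_cons (ZE m leM) big_split.
congr (_ + _); rewrite -big_mkcond (big_pred1 (Ordinal lts)) //.
Qed.

(** In degree 0 the equation gives [Z 0 = g], and in degree n it gives [[lie e, Z (n-1)] = - d n *:
    Z n]. So the n-th iterate of [e] on [g] is a multiple of [Z n] for n <= j, and [d j.+1 = 0] ends
    the chain. *)
Lemma solvable_iter_e j : solvable (- j.+1%:R^-1 *: rho) ->
  iter j.+1 (lie_bracket e) (phi (G (- j.+1%:R^-1 *: rho))) = 0.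
Proof.
set lam := _ *: rho; set g := phi (G lam); move=> [u pu uE].
have nzj : (j.+1%:R : k) != 0 by apply: natr_neq0.
have [Z [M [wZ ZE]]] := in_pos_graded pu.
have e_rho : [lie phi rho, e] = 1 *: e.
  by rewrite linear_sum scaler_sumr; apply: eq_bigr => i _ /=; rewrite phix hc_rho.
have we n : [lie phi rho, [lie e, Z n]] = n.+1%:R *: [lie e, Z n].
  by rewrite (lie_iter_weight 1 e_rho (wZ n)) mulr1 natr1.
pose d n : k := 1 - n%:R / j.+1%:R.
pose W n := d n *: Z n + (if n is p.+1 then [lie e, Z p] else - g).
pose m := maxn M j.+1.
have sumW : \sum_(n < m.+1) W n = 0.
  rewrite big_split /= [X in _ + X]big_ord_recl /=.
  have -> : \sum_(n < m) [lie e, Z n] = [lie e, u].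
    by rewrite (ZE m (leq_maxl _ _)) linear_sum.
  have -> : \sum_(n < m.+1) d n *: Z n = u + [lie phi lam, u].
    rewrite (ZE m.+1 (leqW (leq_maxl _ _))) linear_sum -big_split.
    apply: eq_bigr => n _; rewrite /lam linearZ /= lieZl wZ scalerA.
    by rewrite -[X in X + _]scale1r -scalerDl mulNr mulrC.
  by rewrite addrCA -addrA -lieDl uE addNr.
have W0 n : (n <= m)%N -> W n = 0.
  apply: graded_sum0 sumW n => -[|n].
    rewrite /W linearD linearN linearZ /= wZ !scale0r /g phiC oppr0 addr0.
    by rewrite scaler0.
  by rewrite /W linearD linearZ /= wZ we scalerDr !scalerA mulrC.
have main n : (n <= j)%N -> exists c : k, iter n (lie_bracket e) g = c *: Z n.
  elim: n => [_|n IHn ltn].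
    exists 1; have := W0 0%N isT; rewrite /W /d mul0r subr0 => /eqP.
    by rewrite subr_eq0 => /eqP ->.
  have [c cE] := IHn (ltnW ltn).
  exists (- (c * d n.+1)); rewrite /= cE linearZ /=.
  have := W0 n.+1 (leq_trans ltn (leq_trans (leqnSn j) (leq_maxr _ _))).
  move=> /eqP; rewrite /W addrC addr_eq0 => /eqP ->.
  by rewrite scalerN scalerA scaleNr.
have [c cE] := main j (leqnn j).
rewrite iterS cE linearZ /=.
have := W0 j.+1 (leq_maxr _ _); rewrite /W /d mulfV // subrr scale0r add0r => ->.
by rewrite scaler0.
Qed.

Lemma iter_e_antidominant j :
  iter j.+1 (lie_bracket e) (phi (G (- j.+1%:R^-1 *: rho))) = 0.
Proof. exact/solvable_iter_e/solvable_antidominant. Qed.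

End Solvable.
End PositivePart.

(** * Root vectors of the Langlands dual *)

(* E maps the T-eigenspace of i to that of i + 2, so E^n embeds the n-th layer of
   the filtration of ker T by the kernels of the powers of E into the part of
   ker E of eigenvalue 2 n; these parts are independent. *)
Lemma dim_lker_le (k : fieldType) (V : vectType k) (T E : 'End(V)) :
    [pchar k] =i pred0 -> (forall v, T (E v) = E (T v) + 2%:R *: E v) ->
  (\dim (lker T) <= \dim (lker E))%N.
Proof.
move=> k_char0 TE; pose P n : 'End(V) := iter n (comp_lfun E) \1%VF.
have PE n v : P n v = iter n E v.
  by elim: n => [|n IHn] /=; rewrite ?id_lfunE // comp_lfunE IHn.
have TP n v : T v = 0 -> T (P n v) = (0 + n%:R * 2%:R) *: P n v.
  rewrite PE => Tv; elim: n => [|n IHn] /=; first by rewrite mul0r addr0 scale0r.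
  rewrite TE IHn linearZ -scalerDl; congr (_ *: _).
  by rewrite -[n.+1%:R]natr1; ring.
have two0 : (2%:R : k) != 0 by apply: natr_neq0.
suff main n : exists S : {vspace V},
    [/\ (S <= lker E)%VS, (\dim (lker T :&: lker (P n)) <= \dim S)%N
      & forall v, v \in S -> exists2 Z : nat -> V,
          forall i, T (Z i) = (0 + i%:R * 2%:R) *: Z i & v = \sum_(i < n) Z i].
  have [S [leS dimS _]]   := main (\dim {:V}).
  apply: leq_trans (dimvS leS); apply: leq_trans dimS; apply: dimvS.
  rewrite subv_cap subvv; apply/subvP => v; rewrite !memv_ker => /eqP Tv.
  rewrite (@arithmetic_eigenvectors_vanish _ _ T 0 2%:R k_char0 two0 (P^~ v)) //.
    by move=> m; apply: TP.
  by move=> m; rewrite !PE /= => ->; rewrite linear0.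
elim: n => [|n [S [leS dimS SP]]].
  exists 0%VS; split; first exact: sub0v.
    have -> : lker (P 0%N) = 0%VS.
      apply/eqP; rewrite -subv0; apply/subvP => v.
      by rewrite memv_ker memv0 PE.
    by rewrite capv0.
  move=> v; rewrite memv0 => /eqP ->; exists (fun=> 0); last by rewrite big1.
  by move=> i; rewrite linear0 scaler0.
pose K := (lker T :&: lker (P n.+1))%VS.
have KP v : v \in (P n @: K)%VS ->
    v \in lker E /\ T v = (0 + n%:R * 2%:R) *: v.
  case/memv_imgP=> w; rewrite memv_cap !memv_ker => /andP[/eqP Tw /eqP Pw] ->.
  split; last exact: TP.
  by move: Pw; rewrite !PE /= => ->; rewrite eqxx.
exists (S + P n @: K)%VS; split.
- by rewrite subv_add leS; apply/subvP => v /KP[].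
- rewrite dimv_disjoint_sum; last first.
    apply/eqP; rewrite -subv0; apply/subvP => v.
    rewrite memv_cap memv0 => /andP[/SP[Z wZ vE] /KP[_ wv]].
    apply/negPn/negP => v0.
    have [||||i _] := @weight_of_sum _ V unit (fun=> T) _ (index_enum 'I_n)
      (fun i _ => 0 + i%:R * 2%:R) Z (fun=> 0 + n%:R * 2%:R) v.
    + by move=> i _; apply: wZ.
    + exact: vE.
    + by move=> _; apply: wv.
    + exact: v0.
    move=> /(_ tt) /addrI /(mulIf two0) /(natr_inj_char0 k_char0) eq_in.
    by have := ltn_ord i; rewrite eq_in ltnn.
  rewrite -(limg_ker_dim (P n) K) leq_add2r (leq_trans _ dimS) // dimvS //.
  by rewrite -capvA capvS // capvSr.
- move=> v /memv_addP[a /SP[Z wZ aE] [b /KP[_ wb] ->]].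
  exists (fun i => if i == n then b else Z i).
    by move=> i; case: eqP => [->|].
  rewrite big_ord_recr /= eqxx aE; congr (_ + _); apply: eq_bigr => i _.
  by rewrite ltn_eqF.
Qed.

Section PrincipalTriple.
Context (k : fieldType) (V : lieAlgType k) (H : vectType k) (l : nat).
Hypothesis k_char0 : [pchar k] =i pred0.
Variables (phi : {linear H -> V}) (x : 'I_l -> V) (hc : 'I_l -> 'Hom(H, k^o)).
Variables (tau : H) (fv : V).
Local Notation ev := (\sum_i x i).
Local Notation covector := 'Hom(H, k^o).
Local Notation weight t v := (has_weight (fun lam => lie_bracket (phi lam))
  (fun lam => (t lam : k)) v).
Hypothesis phiC : forall lam mu, [lie phi lam, phi mu] = 0.
Hypothesis x_neq0 : forall i, x i != 0.
Hypothesis phix : forall lam i, [lie phi lam, x i] = (hc i lam : k) *: x i.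
Hypothesis hc_tau : forall i, hc i tau = 2%:R.
Hypothesis hc_inj : forall lam, (forall i, hc i lam = 0) -> lam = 0.
Hypothesis hc_free : forall i j, i != j -> exists lam, hc i lam != hc j lam.
Hypothesis tauf : [lie phi tau, fv] = - 2%:R *: fv.
Hypothesis evfv : [lie ev, fv] = phi tau.
Hypothesis centralizer_tau :
  forall v, [lie phi tau, v] = 0 -> exists lam, v = phi lam.

(** If [ev] kills [v], the string [u] generated by [fv] satisfies [[lie ev, u n.+1] = - (n.+1 *
    n.+2)%:R *: u n]; the factor is never zero, so a non-zero string could not end. *)
Lemma ev_injective_neg v : [lie phi tau, v] = - 2%:R *: v -> [lie ev, v] = 0 ->
  v = 0.
Proof.
move=> wv ev0; pose u n := iter n (lie_bracket fv) v.
have wu n : [lie phi tau, u n] = (- 2%:R + n%:R * - 2%:R) *: u n.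
  exact: lie_iter_weight.
have eu n : [lie ev, u n.+1] = - (n.+1 * n.+2)%:R *: u n.
  elim: n => [|n IHn]; rewrite /= lie_derivation evfv -/(u _).
    by rewrite (wu 0%N) ev0 linear0 addr0 mul0r addr0.
  rewrite (wu n.+1) -[X in [lie fv, X]]/([lie ev, u n.+1]) IHn linearZ /=.
  rewrite -/(u n.+1) -scalerDl; congr (_ *: _).
  by rewrite !natrM -!natr1; ring.
have two0 : (- 2%:R : k) != 0 by rewrite oppr_eq0 natr_neq0.
have uN : u (\dim {:V}) = 0.
  apply: (@arithmetic_eigenvectors_vanish _ _ (lie_bracket (phi tau)) (- 2%:R)
    _ k_char0 two0) => //.
  by move=> n; rewrite /u /= => ->; rewrite linear0.
suff H0 n : u n = 0 -> v = 0 by apply: H0 uN.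
elim: n => // n IHn un0; apply: IHn.
have := eu n; rewrite un0 linear0 => /esym/eqP.
rewrite scaler_eq0 oppr_eq0 -(prednK (n := n.+1 * n.+2)) //.
by rewrite (negPf (natr_neq0 k_char0 _)) => /eqP.
Qed.

(** [[lie x i, z j]] commutes with [phi tau], hence lies in the Cartan subalgebra, so it vanishes
    when its weight [hc i - hc j] is non-zero. For i = j it is non-zero by [ev_injective_neg], and
    [z i] can be rescaled. *)
Lemma opposite_root_vectors (z : 'I_l -> V) :
    (forall i, z i != 0) ->
    (forall lam i, [lie phi lam, z i] = - (hc i lam : k) *: z i) ->
  exists (y : 'I_l -> V) (eta : 'I_l -> H),
    [/\ forall lam i, [lie phi lam, y i] = - (hc i lam : k) *: y i,
        forall i j, i != j -> [lie x i, y j] = 0,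
        forall i, [lie x i, y i] = phi (eta i)
      & forall i, hc i (eta i) = 2%:R].
Proof.
move=> z_neq0 phiz.
have wxz i j lam :
    [lie phi lam, [lie x i, z j]] = ((hc i lam : k) - hc j lam) *: [lie x i, z j].
  by rewrite lie_derivation phix phiz lieZl linearZ /= -scalerDl.
have xzE i j : exists lam, [lie x i, z j] = phi lam.
  by apply: centralizer_tau; rewrite wxz !hc_tau subrr scale0r.
have xz0 i j : i != j -> [lie x i, z j] = 0.
  move=> /hc_free[lam neq]; apply/eqP; have := wxz i j lam.
  have [mu ->] := xzE i j; rewrite phiC => /esym/eqP.
  by rewrite scaler_eq0 subr_eq0 (negPf neq).
have xz_neq0 i : [lie x i, z i] != 0.
  apply: contra_neq (z_neq0 i) => xz; apply: ev_injective_neg.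
    by rewrite phiz hc_tau.
  by rewrite lie_suml (bigD1 i) //= xz big1 ?addr0 // => j /xz0.
(* If hc i vanished on mu, then x i, z i and phi mu would span a Heisenberg
   algebra whose centre acts on the x i-string through x j by a non-zero
   scalar, which is impossible in finite dimension. *)
have eta_neq0 i mu : [lie x i, z i] = phi mu -> (hc i mu : k) != 0.
  move=> xzmu; apply/negP => /eqP hmu0.
  have [j hj] : exists j, hc j mu != 0.
    apply: NNPP => none; case/eqP: (xz_neq0 i).
    rewrite xzmu (hc_inj (lam := mu)) ?linear0 // => j.
    by apply/eqP/negPn/negP => ?; apply: none; exists j.
  have neq_ji : j != i by apply: contra_neq hj => ->.
  pose u n := iter n (lie_bracket (x i)) (x j).
  have wu n : [lie phi mu, u n] = (hc j mu : k) *: u n.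
    have xi : [lie phi mu, x i] = 0 *: x i by rewrite phix hmu0.
    by rewrite (lie_iter_weight n xi (phix mu j)) mulr0 addr0.
  have zu n : [lie z i, u n.+1] = - (n.+1%:R * (hc j mu : k)) *: u n.
    elim: n => [|n IHn]; rewrite /= lie_derivation (lieC (z i)) xzmu lieNl -/(u _).
      by rewrite (wu 0%N) (lieC (z i)) xz0 // oppr0 linear0 addr0 mul1r scaleNr.
    rewrite (wu n.+1) -[X in [lie x i, X]]/([lie z i, u n.+1]) IHn !linearZ /=.
    rewrite scalerN -scaleNr -scalerDl -[in RHS]natr1 mulrDl mul1r opprD.
    by rewrite addrC.
  have uN : u (\dim {:V}) = 0.
    apply: (@arithmetic_eigenvectors_vanish _ _ (lie_bracket (phi tau))
      2%:R 2%:R k_char0).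
    - exact: natr_neq0.
    - by move=> n; apply: lie_iter_weight; rewrite phix hc_tau.
    - by move=> n; rewrite /u /= => ->; rewrite linear0.
  suff H0 n : u n = 0 -> x j = 0 by case/eqP: (x_neq0 j); apply: H0 uN.
  elim: n => // n IHn un0; apply: IHn.
  have := zu n; rewrite un0 linear0 => /esym/eqP.
  by rewrite scaler_eq0 oppr_eq0 mulf_eq0 (negPf (natr_neq0 k_char0 _)) (negPf hj)
    => /eqP.
have [mu muE] := fin_all_exists (fun i => xzE i i).
pose c i : k := 2%:R / hc i (mu i).
exists (fun i => c i *: z i), (fun i => c i *: mu i); split.
- by move=> lam i; rewrite linearZ /= phiz !scalerA mulrC.
- by move=> i j /xz0 xz; rewrite linearZ /= xz scaler0.
- by move=> i; rewrite linearZ /= muE linearZ.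
- move=> i; rewrite linearZ /=; apply: divfK; exact: eta_neq0 (muE i).
Qed.

Definition vector_root (t : covector) := t != 0 /\ exists2 v, v != 0 & weight t v.

(* The product of the two reflections is a transvection, of infinite order
   unless it is trivial. *)
Lemma reflection_unique i (y : V) (alpha eta : H) t :
    (forall lam, [lie phi lam, y] = - (hc i lam : k) *: y) ->
    [lie x i, y] = phi eta -> hc i eta = 2%:R -> hc i alpha = 2%:R ->
    (forall t : covector, vector_root t ->
      vector_root (t - (t alpha : k) *: hc i)) ->
  vector_root t -> t eta = t alpha.
Proof.
move=> phiy xy hc_eta hc_alpha root_alpha root_t.
pose s lam := lam - (hc i lam : k) *: eta.
have hcs lam : hc i (s lam) = - hc i lam.
  have -> : hc i (s lam) = hc i lam - (hc i lam : k) *: hc i eta.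
    by rewrite /s linearB linearZ.
  by rewrite hc_eta; change (hc i lam - (hc i lam : k) * 2 = - (hc i lam : k)); ring.
have sK lam : s (s lam) = lam by rewrite {1}/s hcs scaleNr opprK subrK.
have root_eta (t' : covector) : vector_root t' ->
    vector_root (t' - (t' eta : k) *: hc i).
  set t'' := _ - _; move=> [t'0 [v v0 wv]].
  have t''E lam : t'' lam = t' (s lam).
    have -> : t' (s lam) = t' lam - (hc i lam : k) *: t' eta.
      by rewrite /s linearB linearZ.
    rewrite /t'' add_lfunE opp_lfunE scale_lfunE; congr (_ - _); exact: mulrC.
  have [theta [lin_th th0 thB thphi _]] :=
    reflection_automorphism k_char0 (phix^~ i) phiy xy hc_eta hcs.
  split.
    apply: contra_neq t'0 => t''0; apply/lfunP => lam.
    by rewrite -(sK lam) -t''E t''0 !zero_lfunE.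
  exists (theta v); first by apply: contra_neq v0; apply: th0.
  have thZ c w : theta (c *: w) = c *: theta w.
    have z0 : theta 0 = 0 by have := lin_th (-1) w w; rewrite !scaleN1r !addNr.
    by have := lin_th c w 0; rewrite !addr0 z0 addr0.
  move=> lam /=; rewrite t''E -{1}(sK lam) -thphi -thB.
  by rewrite (wv (s lam)) thZ.
apply/eqP/negPn/negP => neq.
pose d : k := (t eta : k) - t alpha.
have d0 : d != 0 by rewrite subr_eq0.
(* The image of [t] under the n-th power of the transvection; the values of these roots at [alpha]
   form an arithmetic progression. *)
pose tn n : covector := t + (n%:R * d) *: hc i.
have tnE n lam : tn n lam = (t lam : k) + n%:R * d * hc i lam :> k.
  by rewrite add_lfunE scale_lfunE.
have root_tn n : vector_root (tn n).
  elim: n => [|n IHn]; first by rewrite /tn mul0r scale0r addr0.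
  have := root_alpha _ (root_eta _ IHn); congr vector_root; apply/lfunP => lam.
  have subE (t' : covector) (c : k) mu :
      (t' - c *: hc i) mu = (t' mu : k) - c * hc i mu :> k.
    by rewrite add_lfunE opp_lfunE scale_lfunE.
  have haE : (hc i alpha : k) = 2%:R by apply: hc_alpha.
  have heE : (hc i eta : k) = 2%:R by apply: hc_eta.
  apply: (etrans (subE _ _ lam)); apply: (etrans _ (esym (tnE _ lam))).
  rewrite !subE !tnE haE heE -[n.+1%:R]natr1 /d; by ring.
have vex n : exists w, w != 0 /\ weight (tn n) w.
  by have [_ [w w0 ww]] := root_tn n; exists w.
have [v vP] := functional_choice _ vex.
have v0 : v (\dim {:V}) = 0.
  apply: (@arithmetic_eigenvectors_vanish _ _ (lie_bracket (phi alpha))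
    (t alpha) (d * 2%:R) k_char0).
  - by rewrite mulf_neq0 // natr_neq0.
  - by move=> n; rewrite ((vP n).2 alpha) tnE hc_alpha mulrA.
  - by move=> n vn0; case/eqP: (vP n).1.
by case/eqP: (vP (\dim {:V})).1.
Qed.

End PrincipalTriple.

(** * Killing form and coroots *)

Section KillingForm.
Context (k : fieldType) (L : lieAlgType k).
Implicit Types x y z : L.

Definition ad_mx x : 'M[k]_(\dim {:L}) :=
  \matrix_(i, j) coord (vbasis {:L}) j [lie x, (vbasis {:L})`_i].

Lemma lie_vbasisE x (i : 'I_(\dim {:L})) :
  [lie x, (vbasis {:L})`_i] = \sum_j ad_mx x i j *: (vbasis {:L})`_j.
Proof.
by rewrite {1}(coord_vbasis (memvf [lie x, _])); apply: eq_bigr => j _; rewrite mxE.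
Qed.

Lemma killing_formE x y : killing_form x y = \tr (ad_mx y *m ad_mx x).
Proof.
apply: eq_bigr => i _; rewrite mxE (lie_vbasisE y) !linear_sum.
by apply: eq_bigr => j _; rewrite !linearZ /= !mxE.
Qed.

Lemma ad_mx_lie x y : ad_mx [lie x, y] = ad_mx y *m ad_mx x - ad_mx x *m ad_mx y.
Proof.
have mulE u v i j : (ad_mx v *m ad_mx u) i j
    = coord (vbasis {:L}) j [lie u, [lie v, (vbasis {:L})`_i]].
  rewrite mxE (lie_vbasisE v) !linear_sum; apply: eq_bigr => p _.
  by rewrite !linearZ /= !mxE.
by apply/matrixP => i j; rewrite mxE lie_lie linearB /= -!mulE !mxE.
Qed.

Lemma killing_formC x y : killing_form x y = killing_form y x.
Proof. by rewrite !killing_formE mxtrace_mulC. Qed.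

Lemma killing_form_lie x y z :
  killing_form [lie x, y] z = killing_form x [lie y, z].
Proof.
rewrite !killing_formE !ad_mx_lie mulmxBr mulmxBl !linearB /= !mulmxA.
by congr (_ - _); rewrite mxtrace_mulC mulmxA.
Qed.

End KillingForm.

Section Coroots.
Context (k : fieldType) (L : lieAlgType k) (h : {vspace L}).
Implicit Types (a b : lie_dual h) (t s v : subvs_of h).

Lemma lie_vsproj_root a (e f : L) t v : root_striple a e t f ->
  [lie e, [lie f, vsval v]] = (a v : k) *: vsval t.
Proof.
move=> [_ wf ef _]; rewrite (lieC f) wf opp_lfunE scaleNr opprK linearZ /=.
by rewrite ef.
Qed.

Lemma killing_form_coroot a (e f : L) t v : root_striple a e t f ->
  killing_form (vsval t) (vsval v) = (a v : k) * killing_form e f.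
Proof.
move=> [_ wf <- _]; rewrite killing_form_lie (lieC f) wf opp_lfunE scaleNr opprK.
have := killing_formPr (a v : k) e f 0; rewrite addr0 => ->.
have -> : killing_form e 0 = 0 :> k; last by rewrite addr0.
by have := killing_formPr (-1) e 0 0; rewrite scaler0 addr0 mulN1r addNr.
Qed.

Lemma refl_dualE a t b v : refl_dual a t b v = b (refl a t v).
Proof.
have -> : b (refl a t v) = b v - (a v : k) *: b t by rewrite linearB linearZ.
by rewrite /refl_dual add_lfunE opp_lfunE scale_lfunE; congr (_ - _); apply: mulrC.
Qed.

Lemma refl_root a t v : a t = 2%:R -> a (refl a t v) = - a v.
Proof.
move=> at2; have -> : a (refl a t v) = a v - (a v : k) *: a t.
  by rewrite linearB linearZ.
by rewrite at2; change (a v - (a v : k) * 2 = - (a v : k)); ring.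
Qed.

Lemma reflK a t : a t = 2%:R -> involutive (refl a t).
Proof. by move=> at2 v; rewrite {1}/refl refl_root // scaleNr opprK subrK. Qed.

(** The automorphism lifting the reflection carries the root vectors and the s-triple of [b] to
    those of the reflected root. *)
Lemma coroot_refl a (e f : L) t b s : [pchar k] =i pred0 ->
    root_striple a e t f -> is_root b -> is_coroot b s ->
  is_root (refl_dual a t b) /\ is_coroot (refl_dual a t b) (refl a t s).
Proof.
move=> k_char0 [we wf ef at2] [b0 [u u0 wu]] [eb [fb [web wfb efb bs2]]].
have wf' v : [lie vsval v, f] = - (a v : k) *: f by rewrite wf opp_lfunE.
have [theta [lin_th th0 thB thphi _]] :=
  reflection_automorphism (phi := vsval) k_char0 we wf' ef at2
    (fun v => refl_root v at2).
have thZ c w : theta (c *: w) = c *: theta w.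
  have z0 : theta 0 = 0 by have := lin_th (-1) w w; rewrite !scaleN1r !addNr.
  by have := lin_th c w 0; rewrite !addr0 z0 addr0.
have {}thphi r : theta (vsval r) = vsval (refl a t r) by apply: thphi.
have wth (c : lie_dual h) (v : L) :
    weight_vector c v -> weight_vector (refl_dual a t c) (theta v).
  move=> wv r; rewrite refl_dualE -{1}(reflK at2 r) -thphi -thB.
  by rewrite (wv (refl a t r)) thZ.
have two0 : (2%:R : k) != 0 by apply: natr_neq0.
have b's : refl_dual a t b (refl a t s) = 2%:R by rewrite refl_dualE reflK.
split; last first.
  exists (theta eb), (theta fb); split=> //; first exact: wth.
    have -> : - refl_dual a t b = refl_dual a t (- b); last exact: wth.
    by rewrite /refl_dual opprB opp_lfunE scaleNr opprK addrC.
  by rewrite -thB efb thphi.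
split; first by apply: contra_neq two0 => b'0; rewrite -b's b'0 zero_lfunE.
exists (theta u); last exact: wth.
by apply: contra_neq u0; apply: th0.
Qed.

Lemma root_opp a (e f : L) t : [pchar k] =i pred0 -> root_striple a e t f ->
  is_root (- a) /\ is_coroot (- a) (- t).
Proof.
move=> k_char0 [we wf ef at2].
have two0 : (2%:R : k) != 0 by apply: natr_neq0.
have Nat : (- a) (- t) = 2%:R by rewrite opp_lfunE linearN opprK.
have t0 : vsval t != 0.
  apply: contra_neq two0 => t0; rewrite -at2.
  have -> : t = 0 by apply: val_inj; rewrite /= t0.
  by rewrite linear0.
split; last by exists f, e; split; rewrite ?opprK // lieC ef linearN.
split; first by apply: contra_neq two0 => Na0; rewrite -Nat Na0 zero_lfunE.
by exists f => //; apply: contra_neq t0 => f0; rewrite -ef f0 linear0.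
Qed.

End Coroots.

Lemma comp_mpolyK (R : comNzRingType) (n : nat) (lp lq : n.-tuple {mpoly R[n]}) :
  (forall i, comp_mpoly lq (tnth lp i) = 'X_i) ->
  forall p, comp_mpoly lq (comp_mpoly lp p) = p.
Proof.
move=> lpq p; rewrite (comp_mpolyEX p) raddf_sum [RHS]mpolyE; apply: eq_bigr => m _ /=.
rewrite comp_mpolyZ comp_mpolyX rmorph_prod mpolyXE_id; congr (_ *: _).
by apply: eq_bigr => i _; rewrite rmorphXn /= lpq.
Qed.

(** * The Zhelobenko relations *)

Section Zhelobenko.
Context (k : fieldType) (L : lieAlgType k) (h : {vspace L}) (l : nat).
Hypothesis k_char0 : [pchar k] =i pred0.
Variables (alpha : 'I_l -> lie_dual h) (e : 'I_l -> L).
Variables (hc : 'I_l -> subvs_of h) (f : 'I_l -> L) (varpi : 'I_l -> lie_dual h).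
Variables (w : l.-tuple (subvs_of h)) (rho : lie_dual h).
Hypothesis alpha_basis : basis_of fullv [tuple alpha i | i < l].
Hypothesis ehf : forall i, root_striple (alpha i) (e i) (hc i) (f i).
Hypothesis varpi_def : forall i j, varpi i (hc j) = (i == j)%:R.
Hypothesis w_def : forall i, killing_flat (tnth w i) = varpi i.

Lemma dual_family_basis (X : l.-tuple (subvs_of h)) (Y : 'I_l -> lie_dual h) :
  (forall i j, Y i (tnth X j) = (i == j)%:R) -> basis_of fullv X.
Proof.
move=> YX; rewrite basisEfree subvf size_tuple; apply/and3P; split=> //.
  apply/freeP => c; under eq_bigr do rewrite -tnth_nth.
  move=> sum0 i; have := congr1 (Y i) sum0.
  rewrite linear0 linear_sum (bigD1 i) //= linearZ /= YX eqxx big1 ?addr0.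
    by rewrite /GRing.scale /= mulr1.
  by move=> j neq_ji; rewrite linearZ /= YX eq_sym (negPf neq_ji) scaler0.
have := size_basis alpha_basis; rewrite !dimvf => <-.
by rewrite -[X in (_ <= X)%N]/(dim (subvs_of h) * 1)%N muln1.
Qed.

Lemma w_varpi i j : killing_form (vsval (tnth w i)) (vsval (hc j)) = (i == j)%:R.
Proof. by rewrite -killing_flatE w_def varpi_def. Qed.

Lemma w_basis : basis_of fullv w.
Proof.
apply: (dual_family_basis (Y := fun i => killing_flat (hc i))) => i j.
by rewrite killing_flatE killing_formC w_varpi eq_sym.
Qed.

Lemma hc_basis : basis_of fullv [tuple hc i | i < l].
Proof.
apply: (dual_family_basis (Y := varpi)) => i j.
by rewrite tnth_mktuple varpi_def.
Qed.

Lemma lie_dual_eq (lam mu : lie_dual h) : (forall i, lam (hc i) = mu (hc i)) -> lam = mu.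
Proof.
move=> eq_lm; apply/lfunP => v.
have vE : v = \sum_i coord [tuple hc i | i < l] i v *: hc i.
  rewrite {1}(coord_basis hc_basis (memvf v)); apply: eq_bigr => i _.
  by rewrite -tnth_nth tnth_mktuple.
rewrite vE !linear_sum; apply: eq_bigr => i _.
by rewrite !linearZ /= eq_lm.
Qed.

Lemma coord_w (v : subvs_of h) i : coord w i v = killing_form (vsval v) (vsval (hc i)).
Proof.
rewrite killing_formC -killing_flatE {2}(coord_basis w_basis (memvf v)) linear_sum.
rewrite (bigD1 i) //= linearZ /= -tnth_nth killing_flatE killing_formC w_varpi eqxx.
rewrite big1 ?addr0 => [|j neq_ji].
  by rewrite /GRing.scale /= mulr1.
rewrite linearZ /= -tnth_nth killing_flatE killing_formC w_varpi (negPf neq_ji).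
by rewrite scaler0.
Qed.

(** The factor [killing_form (e i) (f i)], whose value never enters, moves from (h_i, h_c) to
    alpha_i(w_j), where it produces (h_i, w_j), a Kronecker symbol. *)
Lemma alpha_w_coord i j c :
  (alpha i (tnth w j) : k) * coord w c (hc i) = (i == j)%:R * alpha i (hc c).
Proof.
rewrite coord_w (killing_form_coroot _ (ehf i)) mulrCA mulrC; congr (_ * _).
by rewrite -(killing_form_coroot _ (ehf i)) killing_formC w_varpi eq_sym.
Qed.

Section Invariant.
Variable J : 'rV[{mpoly k[l]}]_l.
Hypothesis J_inv : zhelobenko_invariant alpha e hc f rho w J.

Local Notation tau i := (translated_act alpha hc rho i).

Lemma zhelobenko_pure_coord i j c b :
  zhelobenko_pure alpha e hc f rho w i (tnth w j) b 0 c
  = tofrac ((coord w c (tnth w j))%:MP * tau i b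
      - ((i == j)%:R * (alpha i (hc c) : k))%:MP * tau i b)
    - tofrac (((i == j)%:R * (alpha i (hc c) : k))%:MP * tau i b) / tofrac 'X_i.
Proof.
have at2 : alpha i (hc i) = 2%:R by have [] := ehf i.
rewrite /zhelobenko_pure /tens !mxE; set v := refl _ _ _.
have -> : vsproj h [lie e i, [lie f i, vsval v]] = - (alpha i (tnth w j) : k) *: hc i.
  rewrite (lie_vsproj_root v (ehf i)) -linearZ vsvalK; congr (_ *: _).
  exact: refl_root.
have -> : coord w c v
    = coord w c (tnth w j) - (i == j)%:R * (alpha i (hc c) : k).
  by rewrite -alpha_w_coord /v /refl linearB linearZ.
rewrite linearZ /= mulNr alpha_w_coord mpolyCB mpolyCN.
set D := ((_ * _)%:MP); rewrite !(rmorphB, rmorphN, rmorphM) /=.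
ring.
Qed.

(** Clearing the denominator in coordinate d gives X_i q_d = X_i tau(q_d) - alpha_i(h_d) (X_i + 1)
    tau(q_i). For d = i this is X_i q_i = -(X_i + 2) tau(q_i), which eliminates tau(q_i). At lam -
    rho the factors X_i + 2 and X_i + 1 become x + 1 and x. *)
Lemma zhelobenko_relation i c :
  ('X_i + 2%:R) * (J 0 c - tau i (J 0 c))
  = (alpha i (hc c) : k)%:MP * (('X_i + 1) * J 0 i).
Proof.
have at2 : alpha i (hc i) = 2%:R by have [] := ehf i.
have X_neq0 : 'X_i != 0 :> {mpoly k[l]}.
  by apply/negP => /eqP X0; have := mcoeffXU k i i; rewrite X0 mcoeff0 eqxx
    => /esym/eqP; rewrite oner_eq0.
have X0 : tofrac ('X_i : {mpoly k[l]}) != 0 by rewrite tofrac_eq0.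
have rel d : 'X_i * J 0 d = 'X_i * tau i (J 0 d)
    - (alpha i (hc d) : k)%:MP * (('X_i + 1) * tau i (J 0 i)).
  pose a : {mpoly k[l]} := (alpha i (hc d) : k)%:MP.
  have sum_delta : \sum_j ((i == j)%:R * (alpha i (hc d) : k))%:MP * tau i (J 0 j)
      = a * tau i (J 0 i).
    rewrite (bigD1 i) //= eqxx mul1r big1 ?addr0 // => j neq_ji.
    by rewrite eq_sym (negPf neq_ji) mul0r mpolyC0 mul0r.
  have sum_coord : \sum_j (coord w d (tnth w j))%:MP * tau i (J 0 j) = tau i (J 0 d).
    transitivity (\sum_(j | j == d) tau i (J 0 j)); last exact: big_pred1_eq.
    rewrite [RHS]big_mkcond.
    apply: eq_bigr => j _; rewrite coord_w w_varpi /=.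
    by rewrite mul_mpolyC; case: (j == d); [rewrite scale1r|rewrite scale0r].
  have relF : tofrac (J 0 d) = tofrac (tau i (J 0 d) - a * tau i (J 0 i))
      - tofrac (a * tau i (J 0 i)) / tofrac 'X_i.
    have := congr1 (fun M : 'rV_l => M 0 d) (J_inv i).
    rewrite /zhelobenko summxE [in X in _ = X]mxE => <-.
    under eq_bigr do rewrite zhelobenko_pure_coord.
    by rewrite sumrB -mulr_suml -!rmorph_sum /= sumrB sum_delta sum_coord.
  apply/eqP; rewrite -tofrac_eq; apply/eqP; rewrite -/a.
  rewrite !(rmorphB, rmorphM, rmorphD, rmorph1) /= relF.
  rewrite !(rmorphB, rmorphM) /=.
  have clear_denominator (F : fieldType) (x b t u : F) : x != 0 ->
      x * (t - b * u - b * u / x) = x * t - b * ((x + 1) * u).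
    by move=> x0; field.
  exact: clear_denominator.
have eliminate (R : comNzRingType) (x b q q' t t' : R) :
    x * q = x * t - b * ((x + 1) * t') -> x * q' = x * t' - 2%:R * ((x + 1) * t') ->
    x * ((x + 2%:R) * (q - t)) = x * (b * ((x + 1) * q')).
  move=> E E'; transitivity ((x + 2%:R) * (x * q - x * t)); first by ring.
  by rewrite E [RHS]mulrCA [x * _ in RHS]mulrCA E'; ring.
apply: (mulfI X_neq0); apply: eliminate; first exact: rel.
by rewrite rel at2 mpolyC_nat.
Qed.

Lemma tau_X i j : tau i ('X_j) = 'X_j + (rho (hc j) : k)%:MP
  - ('X_i + (rho (hc i) : k)%:MP) * (alpha i (hc j) : k)%:MP - (rho (hc j) : k)%:MP.
Proof. by rewrite /translated_act comp_mpolyXU -tnth_nth tnth_mktuple. Qed.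

Lemma translated_actK i : involutive (tau i).
Proof.
have at2 : alpha i (hc i) = 2%:R by have [] := ehf i.
apply: comp_mpolyK => j; rewrite tnth_mktuple.
rewrite !(rmorphB, rmorphD, rmorphM) /= !comp_mpolyC.
rewrite -/(tau i 'X_j) -/(tau i 'X_i) !tau_X at2 mpolyC_nat.
have cancel_id (R : comNzRingType) (x x' a a' b : R) :
    x' + a' - (x + a) * b - a' + a' - (x + a - (x + a) * 2%:R - a + a) * b - a' = x'.
  by ring.
exact: cancel_id.
Qed.

(* The translated reflection is an involution, so the relation for q_i can be
   iterated; a non-zero q_i survives only if rho takes the value 1 on h_i. *)
Lemma rho_hc i : J 0 i != 0 -> rho (hc i) = 1 :> k.
Proof.
have at2 : alpha i (hc i) = 2%:R by have [] := ehf i.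
move=> Ji0; pose x : {mpoly k[l]} := 'X_i; pose a : {mpoly k[l]} := (rho (hc i) : k)%:MP.
have rel : (x + 2%:R) * tau i (J 0 i) = - x * J 0 i.
  have := zhelobenko_relation i i; rewrite at2 mpolyC_nat -/x.
  have solve (R : comNzRingType) (y t q : R) :
      (y + 2%:R) * (q - t) = 2%:R * ((y + 1) * q) -> (y + 2%:R) * t = - y * q.
    by move=> E; have -> : (y + 2%:R) * t = (y + 2%:R) * q - (y + 2%:R) * (q - t);
      [ring|rewrite E; ring].
  exact: solve.
have rel' : (- x - 2%:R * a + 2%:R) * J 0 i = (x + 2%:R * a) * tau i (J 0 i).
  have := congr1 (tau i) rel.
  rewrite /translated_act !(rmorphM, rmorphN, rmorphD, rmorph1) /=.
  rewrite -![comp_mpoly _ _]/(tau i _) translated_actK tau_X at2 mpolyC_nat -/x -/a.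
  have solve (R : comNzRingType) (y b t q : R) :
      (y + b - (y + b) * 2%:R - b + 2%:R) * q = - (y + b - (y + b) * 2%:R - b) * t ->
      (- y - 2%:R * b + 2%:R) * q = (y + 2%:R * b) * t.
    by move=> E; transitivity ((y + b - (y + b) * 2%:R - b + 2%:R) * q);
      [ring|rewrite E; ring].
  exact: solve.
have : 4%:R * ((a - 1) * J 0 i) = 0.
  have : (x + 2%:R) * ((- x - 2%:R * a + 2%:R) * J 0 i)
      = (x + 2%:R * a) * (- x * J 0 i) by rewrite rel' -rel mulrCA.
  have solve (R : comNzRingType) (y b q : R) :
      (y + 2%:R) * ((- y - 2%:R * b + 2%:R) * q) = (y + 2%:R * b) * (- y * q) ->
      4%:R * ((b - 1) * q) = 0.
    move=> E; transitivity ((y + 2%:R * b) * (- y * q)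
      - (y + 2%:R) * ((- y - 2%:R * b + 2%:R) * q)); first by ring.
    by rewrite E subrr.
  exact: solve.
move/eqP; rewrite mulf_eq0 -mpolyC_nat mpolyC_eq0 (negPf (natr_neq0 k_char0 3)) /=.
rewrite mulf_eq0 (negPf Ji0) orbF subr_eq0 -mpolyC1 mpolyC_eq.
by move/eqP.
Qed.

(** The map G; the shift by [rho] turns the translated action into the plain reflection. *)
Definition shifted_invariant (lam : lie_dual h) : lie_dual h :=
  \sum_c speval hc (J 0 c) (lam - rho) *: varpi c.

Lemma sum_varpi_hc (q : 'I_l -> k) i : (\sum_c q c *: varpi c) (hc i) = q i :> k.
Proof.
rewrite sum_lfunE (bigD1 i) //= scale_lfunE varpi_def eqxx big1 ?addr0.
  exact: mulr1.
by move=> j neq_ji; rewrite scale_lfunE varpi_def (negPf neq_ji) scaler0.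
Qed.

Lemma shifted_invariant_refl i (lam : lie_dual h) : rho (hc i) = 1 :> k ->
  ((lam (hc i) : k) + 1) *: (shifted_invariant lam
     - shifted_invariant (refl_dual (alpha i) (hc i) lam))
  = ((lam (hc i) : k) * shifted_invariant lam (hc i)) *: alpha i.
Proof.
move=> rho1; apply: lie_dual_eq => c.
rewrite !(add_lfunE, opp_lfunE, scale_lfunE) !sum_varpi_hc.
pose mu := lam - rho.
have : ((mu (hc i) : k) + 2%:R) * (speval hc (J 0 c) mu - speval hc (tau i (J 0 c)) mu)
    = (alpha i (hc c) : k) * (((mu (hc i) : k) + 1) * speval hc (J 0 i) mu).
  have := congr1 (meval (fun p => mu (hc p) : k)) (zhelobenko_relation i c).
  by rewrite !(mevalM, mevalD, mevalN, mevalXU, mevalC, meval1); apply.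
rewrite translated_actE /mu subrK add_lfunE opp_lfunE rho1 subrK.
have -> : (lam (hc i) : k) - 1 + 2%:R = (lam (hc i) : k) + 1 by ring.
by move=> E; apply: (etrans E); apply: etrans (mulrC _ _) _.
Qed.

End Invariant.
End Zhelobenko.

(** * Polynomials along the line spanned by [rho] *)

Lemma poly_vector_vanish (k : fieldType) (V : vectType k) (l m : nat)
    (v : 'I_l -> V) (p : 'I_l -> {poly k}) (r : nat -> k) :
    injective r -> (forall i, size (p i) <= m.+1)%N ->
    (forall j, (j <= m)%N -> \sum_i (p i).[r j] *: v i = 0) ->
  forall s, \sum_i (p i).[s] *: v i = 0.
Proof.
move=> r_inj szp van s; rewrite [LHS](coord_vbasis (memvf _)) big1 // => c _.
pose q := \sum_i coord (vbasis {:V}) c (v i) *: p i.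
have qE t : coord (vbasis {:V}) c (\sum_i (p i).[t] *: v i) = q.[t].
  rewrite linear_sum horner_sum; apply: eq_bigr => i _.
  by rewrite linearZ /= hornerZ mulrC.
rewrite qE (_ : q = 0) ?horner0 ?scale0r //.
apply: (@roots_geq_poly_eq0 _ q (map r (iota 0 m.+1))).
- apply/allP => t /mapP[j]; rewrite mem_iota ltnS => le_jm ->.
  by rewrite /root -qE van ?linear0.
- by rewrite map_inj_uniq ?iota_uniq.
rewrite size_map size_iota; apply: leq_trans (size_sum _ _ _) _.
by apply/bigmax_leqP => i _; apply: leq_trans (size_scale_leq _ _) (szp i).
Qed.

Lemma speval_line (k : fieldType) (L : lieAlgType k) (h : {vspace L}) (l : nat)
    (hc : 'I_l -> subvs_of h) (rho : lie_dual h) (q : {mpoly k[l]}) :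
    (forall i, rho (hc i) = 1 :> k) ->
  exists2 p : {poly k}, (size p <= msize q)%N
    & forall s, speval hc q (s *: rho) = p.[s].
Proof.
move=> rho1; exists (\sum_(m <- msupp q) q@_m *: 'X^(mdeg m)).
  rewrite big_seq; elim/big_ind: _ => [|p1 p2 s1 s2|m mq].
  - by rewrite size_poly0.
  - by apply: leq_trans (size_polyD _ _) _; rewrite geq_max s1.
  apply: leq_trans (size_scale_leq _ _) _; rewrite size_polyXn.
  exact: msize_mdeg_lt.
move=> s; rewrite /speval mevalE horner_sum; apply: eq_bigr => m _.
rewrite hornerZ hornerXn mdegE -prodrXr; congr (_ * _); apply: eq_bigr => i _.
by congr (_ ^+ _); rewrite scale_lfunE rho1; apply: mulr1.
Qed.

Section EvaluationCovector.
Context (k : fieldType) (H : vectType k).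

(** The embedding into the bidual: a coroot of g becomes a linear form on h^*, where the roots of
    g^v live. *)
Definition ev_covector (v : H) : 'Hom('Hom(H, k^o), k^o) :=
  linfun (fun lam : 'Hom(H, k^o) => lam v : k^o).

Lemma ev_covectorE v (lam : 'Hom(H, k^o)) : ev_covector v lam = lam v.
Proof.
pose F (lam : 'Hom(H, k^o)) : k^o := lam v.
have linF : linear F by move=> a x y; rewrite /F add_lfunE scale_lfunE.
pose FL := GRing.isLinear.Build _ _ _ _ F linF.
pose G : {linear 'Hom(H, k^o) -> k^o} := HB.pack F FL.
exact: (lfunE G lam).
Qed.

End EvaluationCovector.

(** * The structure of the Langlands dual and the conclusion *)

Theorem theorem8p6
  (k : closedFieldType) (k_char0 : [pchar k] =i pred0)
  (* the simple Lie algebra, a Cartan subalgebra, simple and positive roots *)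
  (g : lieAlgType k) (g_simple : lie_simple g)
  (h : {vspace g}) (h_cartan : cartan_subalgebra h)
  (l : nat) (alpha : 'I_l -> lie_dual h) (alpha_base : is_base alpha)
  (Dpos : seq (lie_dual h)) (Dpos_def : enumerates_positive_roots alpha Dpos)
  (* the s-triples of the simple roots *)
  (e : 'I_l -> g) (hc : 'I_l -> subvs_of h) (f : 'I_l -> g)
  (ehf : forall i, root_striple (alpha i) (e i) (hc i) (f i))
  (* the fundamental weights, in h^* and in h *)
  (varpi : 'I_l -> lie_dual h)
  (varpi_def : forall i j, varpi i (hc j) = (i == j)%:R)
  (w : l.-tuple (subvs_of h))
  (w_def : forall i, killing_flat (tnth w i) = varpi i)
  (* the Langlands dual and its principal s-triple *)
  (gv : lieAlgType k) (gv_simple : lie_simple gv)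
  (hv : {vspace gv}) (hv_cartan : cartan_subalgebra hv)
  (phi : {linear lie_dual h -> subvs_of hv})
  (phi_dual : langlands_identification phi)
  (ev tv fv : gv)
  (ev_principal :
    adapted_principal_striple hc (half_sum Dpos) phi ev tv fv)
  (* the Zhelobenko invariant \sum_i w_i (x) J 0 i *)
  (J : 'rV[{mpoly k[l]}]_l) (J_neq0 : J != 0)
  (J_inv : zhelobenko_invariant alpha e hc f (half_sum Dpos) w J)
  (m : nat) (J_deg : forall i, msize (J 0 i) = m.+1) :
  forall s : k,
    iter m.+1 (lie_bracket ev)
      (vsval (phi (killing_flat
        (\sum_i speval hc (J 0 i) (s *: half_sum Dpos) *: tnth w i)))) = 0.
Proof.
set rho := half_sum Dpos in ev_principal J_inv *.
have [alpha_basis alpha_root _] := alpha_base.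
have Ji0 i : J 0 i != 0.
  by apply: contra_eq_neq (J_deg i) => ->; rewrite msize0.
have rho1 i : rho (hc i) = 1 :> k.
  exact: (rho_hc k_char0 alpha_basis ehf varpi_def w_def J_inv (Ji0 i)).
have [[tev tfv efv dim_ker] [c tvE] [x [xP evE]]] := ev_principal.
have [psi phiK psiK] := phi_dual.1.
pose ph : {linear lie_dual h -> gv} := (vsval \o phi).
pose hc' i := ev_covector (hc i).
have hc'E i lam : hc' i lam = lam (hc i) by apply: ev_covectorE.
have x_neq0 i : x i != 0 by have [] := xP i.
have phx lam i : [lie ph lam, x i] = (hc' i lam : k) *: x i.
  by rewrite hc'E; have [_] := xP i; apply.
(* The Cartan subalgebra is abelian: a bracket [ph nu] acts on each [x i] by a commutator of
   scalars, so every [hc' i] kills [nu]. *)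
have phC lam mu : [lie ph lam, ph mu] = 0.
  have [brac _ _] := hv_cartan.
  have := brac _ _ (subvsP (phi lam)) (subvsP (phi mu)).
  move=> /vsprojK; rewrite -(psiK (vsproj hv _)).
  set nu := psi _ => nuE; rewrite -[LHS]nuE.
  have -> : nu = 0; last by rewrite !linear0.
  apply: (lie_dual_eq alpha_basis varpi_def) => i; rewrite zero_lfunE.
  have := phx nu i; rewrite /ph /= nuE lie_lie -!/(ph _) !phx !linearZ /= !phx.
  rewrite scalerN !scalerA mulrC subrr hc'E => /esym/eqP.
  by rewrite scaler_eq0 (negPf (x_neq0 i)) orbF => /eqP.
have ph_inj lam : ph lam = 0 -> lam = 0.
  move=> ph0; apply: (can_inj phiK); rewrite linear0.
  by apply: val_inj; apply: ph0.
have ph_hv v : v \in hv -> exists lam, v = ph lam.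
  by move=> v_hv; exists (psi (vsproj hv v)); rewrite /= psiK vsprojK.
pose tau := c *: rho.
(* [tv] multiplies [ev] by [c] and also by 2; bracketing with [varpi i] isolates the summand [x i],
   which gives [c = 2]. *)
have hc_tau i : hc' i tau = 2%:R.
  have c2 : (c - 2%:R) *: ev = 0.
    rewrite scalerBl -tev tvE evE !linear_sum -big_split big1 // => j _.
    by rewrite -/(ph _) /= phx hc'E scale_lfunE rho1 [_ *: 1]mulr1 subrr.
  have : [lie ph (varpi i), (c - 2%:R) *: ev] = 0 by rewrite c2 linear0.
  rewrite linearZ evE linear_sum /= (bigD1 i) //= phx hc'E varpi_def eqxx.
  rewrite big1 => [|j neq_ji].
    rewrite addr0 scale1r => /eqP; rewrite scaler_eq0 (negPf (x_neq0 i)) orbF.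
    by rewrite subr_eq0 hc'E scale_lfunE rho1 => /eqP <-; apply: mulr1.
  by rewrite phx hc'E varpi_def eq_sym (negPf neq_ji) scale0r.
have hc_inj lam : (forall i, hc' i lam = 0) -> lam = 0.
  move=> lam0; apply: (lie_dual_eq alpha_basis varpi_def) => i.
  by rewrite zero_lfunE -hc'E.
have hc_free i j : i != j -> exists lam, hc' i lam != hc' j lam.
  move=> neq_ij; exists (varpi i); rewrite !hc'E !varpi_def eqxx (negPf neq_ij).
  exact: oner_neq0.
have tauf : [lie ph tau, fv] = - 2%:R *: fv.
  by rewrite /ph /= -tvE tfv scaleNr.
have evfv : [lie \sum_i x i, fv] = ph tau by rewrite -evE efv tvE.
(* [hv] lies in the kernel of [ad tv], whose dimension is at most that of the kernel of [ad ev], the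
   dimension of [hv]. *)
have centralizer v : [lie ph tau, v] = 0 -> exists lam, v = ph lam.
  rewrite /ph /= -tvE => tv0; apply: (ph_hv).
  pose T := linfun (lie_bracket tv); pose E := linfun (lie_bracket ev).
  have leT : (hv <= lker T)%VS.
    apply/subvP => _ /ph_hv[lam ->]; rewrite memv_ker lfunE /= tvE.
    by rewrite -/(ph _) phC.
  have TE u : T (E u) = E (T u) + 2%:R *: E u.
    by rewrite !lfunE /= lie_derivation tev lieZl addrC.
  have := dim_lker_le k_char0 TE; rewrite dim_ker => le_dim.
  have [_ dimE] := dimv_leqif_eq leT.
  have /eqP -> : hv == lker T by rewrite -dimE eqn_leq (dimvS leT).
  by rewrite memv_ker lfunE /= tv0.
pose coroot (t : subvs_of h) := exists b : lie_dual h, is_root b /\ is_coroot b t.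
have lker0 : lker (linfun phi) == 0%VS.
  by apply/lker0P => u v; rewrite !lfunE => /(can_inj phiK).
have root_vr t : coroot t -> vector_root ph (ev_covector t).
  move=> [b [rb cb]].
  pose cov : lie_dual hv := (ev_covector t \o (linfun phi)^-1)%VF.
  have covE lam : cov (phi lam) = lam t.
    rewrite comp_lfunE -[phi lam](lfunE phi) lker0_lfunK //.
    exact: ev_covectorE.
  have [cov0 [u u0 wu]] : is_root cov by apply/phi_dual.2; exists b, t.
  split.
    by apply: contra_neq cov0 => t0; rewrite /cov t0 comp_lfun0l.
  by exists u => // lam /=; rewrite wu covE ev_covectorE.
have vr_root (chi : 'Hom(lie_dual h, k^o)) : vector_root ph chi ->
    exists2 t, coroot t & chi = ev_covector t.
  move=> [chi0 [u u0 wu]].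
  pose cov : lie_dual hv := (chi \o (linfun phi)^-1)%VF.
  have covE lam : cov (phi lam) = chi lam.
    by rewrite comp_lfunE -[phi lam](lfunE phi) lker0_lfunK.
  have /phi_dual.2[b [t [rb cb tE]]] : is_root cov.
    split.
      apply: contra_neq chi0 => cov0; apply/lfunP => lam.
      by rewrite -covE cov0 !zero_lfunE.
    by exists u => // s; rewrite -(psiK s) covE -(wu (psi s)).
  exists t; first by exists b.
  by apply/lfunP => lam; rewrite -covE tE ev_covectorE.
have z_ex i : exists u : gv, u != 0 /\
    forall lam, [lie ph lam, u] = - (hc' i lam : k) *: u.
  have [_ [u u0 wu]] : vector_root ph (ev_covector (- hc i)).
    by apply: (root_vr); exists (- alpha i); apply: (root_opp k_char0 (ehf i)).
  exists u; split=> // lam; rewrite (wu lam) ev_covectorE linearN hc'E.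
  by [].
have [z zP] := fin_all_exists z_ex.
have [y [eta [phy xy0 xy hc_eta]]] := opposite_root_vectors k_char0 phC x_neq0
  phx hc_tau hc_inj hc_free tauf evfv centralizer (fun i => (zP i).1)
  (fun lam i => (zP i).2 lam).
have hc_alpha i : hc' i (alpha i) = 2%:R by rewrite hc'E; have [] := ehf i.
have root_alpha i (chi : 'Hom(lie_dual h, k^o)) : vector_root ph chi ->
    vector_root ph (chi - (chi (alpha i) : k) *: hc' i).
  move=> /vr_root[t [b [rb cb]] ->].
  have -> : ev_covector t - (ev_covector t (alpha i) : k) *: hc' i
      = ev_covector (refl (alpha i) (hc i) t).
    apply/lfunP => lam; rewrite add_lfunE opp_lfunE scale_lfunE !ev_covectorE.
    have -> // : lam (refl (alpha i) (hc i) t) = lam t - (alpha i t : k) *: lam (hc i).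
    by rewrite linearB linearZ.
  apply: (root_vr); exists (refl_dual (alpha i) (hc i) b).
  exact: (coroot_refl k_char0 (ehf i)).
(* Both sides are compared on the forms [hc' j]. Reflection by [alpha i] preserves the roots of g^v
   because the reflections of g preserve its coroots. *)
have eta_alpha i : eta i = alpha i.
  apply: (lie_dual_eq alpha_basis varpi_def) => j; rewrite -!hc'E.
  apply: (reflection_unique k_char0 phx (phy^~ i) (xy i)) => //.
    exact: root_alpha.
  apply: (root_vr); exists (alpha j); split=> //.
  by exists (e j), (f j).
have xy_alpha i : [lie x i, y i] = ph (alpha i) by rewrite xy eta_alpha.
have hc_rho i : hc' i rho = 1 by rewrite hc'E.
pose G := shifted_invariant hc varpi rho J.
have G_refl i lam : ((hc' i lam : k) + 1) *: (G lam - G (srefl alpha hc' i lam))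
    = ((hc' i lam : k) * hc' i (G lam)) *: alpha i.
  rewrite /srefl !hc'E.
  exact: (shifted_invariant_refl alpha_basis ehf varpi_def w_def J_inv).
have vanish j := iter_e_antidominant k_char0 ph_inj phC phx phy xy_alpha xy0
  hc_alpha hc_rho G_refl j.
have flatE (q : 'I_l -> k) :
    killing_flat (\sum_i q i *: tnth w i) = \sum_i q i *: varpi i.
  apply: (lie_dual_eq alpha_basis varpi_def) => i.
  rewrite (sum_varpi_hc varpi_def) killing_flatE -(coord_w alpha_basis varpi_def w_def).
  under eq_bigr do rewrite (tnth_nth 0).
  by rewrite coord_sum_free // (basis_free (w_basis alpha_basis varpi_def w_def)).
have p_ex i : exists p : {poly k}, (size p <= m.+1)%N /\
    forall s, speval hc (J 0 i) (s *: rho) = p.[s].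
  have [p szp pE] := speval_line (J 0 i) rho1.
  by exists p; split=> //; rewrite -(J_deg i).
have [p pP] := fin_all_exists p_ex.
pose v i := iter m.+1 (lie_bracket ev) (ph (varpi i)).
have iterE s : iter m.+1 (lie_bracket ev) (ph (\sum_i (p i).[s] *: varpi i))
    = \sum_i (p i).[s] *: v i.
  rewrite linear_sum iter_lie_sum; apply: eq_bigr => i _.
  by rewrite linearZ iter_lieZ.
move=> s; rewrite flatE -/(ph _).
under eq_bigr do rewrite (pP _).2.
rewrite iterE.
(* Because of the shift by [rho], G at -rho/(j+1) is the invariant at (-1/(j+1) - 1) rho. *)
pose r (j : nat) : k := - j.+1%:R^-1 - 1.
apply: (@poly_vector_vanish _ _ _ m _ _ r) => [i j|i|j le_jm].
- by move/addIr/oppr_inj/invr_inj/(natr_inj_char0 k_char0) => -[].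
- exact: (pP i).1.
rewrite -iterE; apply: (iter_lie_eq0 (m := j.+1)); first by rewrite ltnS.
rewrite evE -[RHS](vanish j); congr (iter _ _ (ph _)).
apply: eq_bigr => i _; congr (_ *: _); rewrite -(pP i).2; congr (speval _ _ _).
by rewrite scalerBl scale1r.
Qed.
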